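(* For all $n\ge 1$ and $\ell\ge 1$, all middle orders on $\mathfrak S_n$ have the same number of boolean chains of length $\ell$, which is equal to $$\sum_{k=0}^{\ell}(-1)^{\ell-k}\binom{\ell}{k}\prod_{i=0}^{n-1}\binom{k}{i}.$$
   Context: A middle order on $\mathfrak S_n$ is a partial order $\preceq$ on $\mathfrak S_n$ such that $(\mathfrak S_n,\preceq)$ is a distributive lattice and $v\le_R w\Rightarrow v\preceq w\Rightarrow v\le w$ for all $v,w$. Here $\le$ is the Bruhat order and $\le_R$ is the right weak order: writing permutations as words, $v\le_R w$ iff every pair of values $i<j$ with $j$ before $i$ in $v$ also has $j$ before $i$ in $w$. In a finite lattice, a (complete) boolean chain of length $\ell$ is a chain $x_0<x_1<\dots<x_\ell$ containing the minimum and the maximum of the lattice such that for all $0\le i<\ell$ the interval $[x_i,x_{i+1}]$ is a boolean lattice. *)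

(* Defs.v *)
(* MathComp *)
From HB Require Import structures.
From mathcomp Require Import all_boot all_order all_fingroup all_algebra.

Set Implicit Arguments.
Unset Strict Implicit.
Unset Printing Implicit Defensive.

Import Order.Theory.
Local Open Scope order_scope.

(* A permutation w : 'S_n is the word w 0, w 1, ..., w (n-1), so the position
   of the value i in this word is (w^-1)%g i. *)
Definition before (n : nat) (w : 'S_n) (a b : 'I_n) : bool :=
  (((w^-1)%g a : nat) < (w^-1)%g b)%N.

Definition right_weak_le (n : nat) (v w : 'S_n) : bool :=
  [forall i : 'I_n, forall j : 'I_n,
     ((i : nat) < j)%N && before v j i ==> before w j i].

Definition inversions (n : nat) (w : 'S_n) : {set 'I_n * 'I_n} :=
  [set p : 'I_n * 'I_n | ((p.1 : nat) < p.2)%N && ((w p.2 : nat) < w p.1)%N].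

(* Since (tperm i j * v)%g k = v (tperm i j k), this exchanges the letters of v
   in positions i and j; the cardinal of the inversion set is the Coxeter
   length. *)
Definition bruhat_step (n : nat) (v w : 'S_n) : bool :=
  [exists i : 'I_n, exists j : 'I_n, w == (tperm i j * v)%g]
    && (#|inversions v| < #|inversions w|)%N.

Definition bruhat_le (n : nat) (v w : 'S_n) : bool :=
  connect (@bruhat_step n) v w.

(* The fields mid_meet and mid_join are determined by mid_le through
   mid_meetP and mid_joinP. *)
Record middle_order (n : nat) : Type := MiddleOrder {
  mid_le : rel 'S_n;
  mid_refl : reflexive mid_le;
  mid_anti : antisymmetric mid_le;
  mid_trans : transitive mid_le;
  mid_meet : 'S_n -> 'S_n -> 'S_n;
  mid_join : 'S_n -> 'S_n -> 'S_n;
  mid_meetP : forall u v w : 'S_n,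
    mid_le u (mid_meet v w) = mid_le u v && mid_le u w;
  mid_joinP : forall u v w : 'S_n,
    mid_le (mid_join u v) w = mid_le u w && mid_le v w;
  mid_meetUl : left_distributive mid_meet mid_join;
  mid_weak : forall v w : 'S_n, right_weak_le v w -> mid_le v w;
  mid_bruhat : forall v w : 'S_n, mid_le v w -> bruhat_le v w
}.

(* An alias of 'S_n, whose canonical order is mid_le M. *)
Definition ordered_perm (n : nat) (M : middle_order n) : Type := 'S_n.

HB.instance Definition _ (n : nat) (M : middle_order n) :=
  Finite.copy (ordered_perm M) {perm 'I_n}.
HB.instance Definition _ (n : nat) (M : middle_order n) :=
  Order.Le_isPOrder.Build (Order.Disp tt tt) (ordered_perm M)
    (@mid_refl n M) (@mid_anti n M) (@mid_trans n M).
HB.instance Definition _ (n : nat) (M : middle_order n) :=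
  Order.POrder_MeetJoin_isLattice.Build (Order.Disp tt tt) (ordered_perm M)
    (@mid_meetP n M) (@mid_joinP n M).
HB.instance Definition _ (n : nat) (M : middle_order n) :=
  Order.Lattice_Meet_isDistrLattice.Build (Order.Disp tt tt) (ordered_perm M)
    (@mid_meetUl n M).

Definition itv (d : Order.disp_t) (L : finLatticeType d) (x y : L) : {set L} :=
  [set z | x <= z <= y].

(* A boolean lattice is a complemented distributive lattice. The interval
   [x, y] is closed under the meet and join of L, and its bottom and top
   are x and y. *)
Definition boolean_itv (d : Order.disp_t) (L : finLatticeType d) (x y : L) : bool :=
  [&& x <= y,
      [forall a in itv x y, forall b in itv x y, forall c in itv x y,
         a `&` (b `|` c) == (a `&` b) `|` (a `&` c)] &
      [forall a in itv x y, exists b in itv x y,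
         (a `&` b == x) && (a `|` b == y)]].

Definition boolean_chain (d : Order.disp_t) (L : finLatticeType d) (c : seq L) :
  bool :=
  [&& sorted <%O c,
      [exists z in c, forall y : L, z <= y],
      [exists z in c, forall y : L, y <= z] &
      sorted (@boolean_itv d L) c].

(* A chain of length l has l + 1 elements. *)
Definition boolean_chains (d : Order.disp_t) (L : finLatticeType d) (l : nat) :
  {set l.+1.-tuple L} := [set c : l.+1.-tuple L | boolean_chain c].

(* Main.v *)
(* The lattice of a middle order is distributive and graded by the number of inversions. Write
   [W lo hi] for the permutations that move only values in [lo, hi); it is an interval of the
   middle order. The key point is that every such interval with at least two values has a
   "root" r: the transposition of r - 1 and r lies below the cycles moving a value i < r up to
   position r, and below the cycles moving a value k >= r down to position r - 1. Roots exist by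
   induction on hi - lo, because the two cycles moving lo and hi - 1 across the whole interval
   have exactly one atom in common. Throughout, a join is identified by comparing its rank with
   the number of inversions which Bruhat order forces on it.

   At a root r the interval splits as W lo r x W r hi x [1, u], where u exchanges the blocks
   [lo, r) and [r, hi), and [1, u] is the lattice of partitions in an (r - lo) x (hi - r) box.
   Multichains with k boolean steps multiply over products. In an a x b box they are counted by
   the determinant of the binomials (k - i choose lam_i - i + j), whose value at the full box is
   H (a + b) / (H a * H b) with H m = prod_(i < m) (k choose i). So W lo hi has H (hi - lo)
   multichains whatever the roots are, and binomial inversion in k gives the strict chains. *)

Require Import Defs.
From HB Require Import structures.
From mathcomp Require Import all_boot all_order all_fingroup all_algebra.
From mathcomp Require Import zify ring.

Set Implicit Arguments.
Unset Strict Implicit.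
Unset Printing Implicit Defensive.

Import Order.Theory GRing.Theory.

(** * The rank of a finite distributive lattice *)

(** [M] is known only through its bounds: weak order produces comparisons, Bruhat order extracts
    consequences from them, and meets and joins have no formula. All the freedom in [M] lies in its
    roots. Below the block exchange [u] of a root there is none: [gen r] is the only atom under [u],
    so every element under [u] keeps the values of each of the two blocks in increasing order, and
    on such shuffles weak and Bruhat order agree. A boolean step under [u] adds an antichain of
    cells, so a multichain from the bottom to [u] is a filling of the rectangle that increases
    strictly along rows and columns; this is where a determinant becomes available. Multichains
    replace strict chains because a proper step in a product may be trivial in one factor. *)

Section DistrLattice.
Local Open Scope order_scope.
Variables (d : Order.disp_t) (L : finDistrLatticeType d).
Implicit Types x y z e p q : L.

Definition join_prime e p : bool :=
  (p != e) && [forall a : L, forall b : L, (p <= a `|` b) ==> (p <= a) || (p <= b)].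

Definition join_prime_count e x := #|[set p | join_prime e p & p <= x]|.

Lemma join_prime_le e p x y :
  join_prime e p -> (p <= x `|` y) = (p <= x) || (p <= y).
Proof.
case/andP=> _ /forallP/(_ x)/forallP/(_ y)/implyP H.
apply/idP/idP => [//|/orP[] h]; apply: le_trans h _; [exact: leUl|exact: leUr].
Qed.

(** A [p] below [x] but not below [y] with least [f] works: if it were below the join of [a] and [b]
    but below neither, its meets with them would be strictly smaller, hence below [y] by minimality,
    and distributivity would put [p] below [y]. *)
Lemma join_prime_exists e x y (f : L -> nat) :
    (forall u v, u < v -> (f u < f v)%N) -> (forall u, e <= u) ->
  ~~ (x <= y) -> exists2 p, join_prime e p & (p <= x) && ~~ (p <= y).
Proof.
move=> f_lt e_le nxy.
have Px : (x <= x) && ~~ (x <= y) by rewrite lexx.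
case: (@arg_minnP _ x (fun p => (p <= x) && ~~ (p <= y)) f Px) => p Pp pmin.
exists p => //; case/andP: Pp => px npy; apply/andP; split.
  by apply: contraNneq npy => ->.
apply/forallP => a; apply/forallP => b; apply/implyP => pab.
have below c : ~~ (p <= c) -> p `&` c <= y.
  move=> npc; have lt_pc : p `&` c < p by rewrite lt_neqAle leIl andbT -leEmeet.
  apply: contraT => nle; have := pmin (p `&` c).
  rewrite nle (le_trans (leIl _ _) px) => /(_ isT).
  by rewrite leqNgt f_lt.
apply: contraR npy; rewrite negb_or => /andP[npa npb].
have -> : p = (p `&` a) `|` (p `&` b) by rewrite -meetUr; apply/esym/meet_l.
by rewrite leUx !below.
Qed.

Lemma join_prime_countUI e x y :
  (join_prime_count e (x `|` y) + join_prime_count e (x `&` y) =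
   join_prime_count e x + join_prime_count e y)%N.
Proof.
rewrite /join_prime_count -[RHS]cardsUI; congr addn; apply: eq_card => p; rewrite !inE.
  by case: (boolP (join_prime e p)) => //= h; rewrite (join_prime_le _ _ h).
by rewrite lexI; case: (join_prime e p).
Qed.

(* Any such [f] equals [join_prime_count e]: a coatom of [u] misses at most one
   join-prime below [u]. *)
Lemma rank_modular e (f : L -> nat) x y :
    (forall u v, u < v -> (f u < f v)%N) -> (forall u, e <= u) -> f e = 0%N ->
    (forall u, u != e -> exists2 v, v < u & (f u <= (f v).+1)%N) ->
  (f (x `|` y) + f (x `&` y) = f x + f y)%N.
Proof.
move=> f_lt e_le fe f_down.
have cnt_lt u v : u < v -> (join_prime_count e u < join_prime_count e v)%N.
  move=> uv; have nvu : ~~ (v <= u) by rewrite lt_geF.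
  have [p pp /andP[pv npu]] := join_prime_exists f_lt e_le nvu.
  apply: proper_card; apply/properP; split.
    by apply/subsetP => q; rewrite !inE => /andP[-> /le_trans]; apply; apply: ltW.
  by exists p; rewrite !inE pp ?pv.
have cnt_e : join_prime_count e e = 0%N.
  apply/eqP; rewrite cards_eq0; apply/eqP/setP => p; rewrite !inE.
  apply/negP => /andP[/andP[/eqP pe _] h]; apply: pe.
  by apply/eqP; rewrite eq_le h e_le.
suff cntE u : join_prime_count e u = f u by rewrite -!cntE join_prime_countUI.
apply/eqP; rewrite eqn_leq; apply/andP; split.
  elim/ltn_ind: {u}(f u) {-2}u (erefl (f u)) => m IH u fu.
  case: (eqVneq u e) => [->|ue]; first by rewrite cnt_e.
  have lt_eu : e < u by rewrite lt_neqAle eq_sym ue e_le.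
  case: (@arg_maxnP _ e (fun v => v < u) f lt_eu) => v vu vmax.
  have Hv := IH (f v); rewrite -fu in Hv; have {}Hv := Hv (f_lt _ _ vu) v erefl.
  apply: leq_trans (leq_ltn_trans Hv (f_lt _ _ vu)).
  (* [v] has maximal [f] among the elements below [u], so nothing lies strictly between them. *)
  have top p : p <= u -> ~~ (p <= v) -> v `|` p = u.
    move=> pu npv; apply/eqP; apply: contraT => ne.
    have lt1 : v `|` p < u by rewrite lt_neqAle ne leUx (ltW vu).
    have lt2 : v < v `|` p 
      by rewrite lt_neqAle leUl andbT; apply: contraNneq npv => ->; exact: leUr.
    by have /= := vmax _ lt1; rewrite /geq /= leqNgt f_lt.
  (* For two join-primes [p] and [q] under [u] but not under [v], the join of [v] and [p] is [u], so
     primality puts [q] under [p], and symmetrically. *)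
  have sub1 : (#|[set p | join_prime e p & (p <= u)%O]
                 :\: [set p | join_prime e p & (p <= v)%O]| <= 1)%N.
    apply/card_le1_eqP => p q; rewrite !inE => /andP[h1 /andP[jp pu]] /andP[h2 /andP[jq qu]].
    rewrite jp /= in h1; rewrite jq /= in h2.
    have lqp : q <= p by have := join_prime_le v p jq; rewrite top // qu (negPf h2).
    have lpq : p <= q by have := join_prime_le v q jp; rewrite top // pu (negPf h1).
    by apply/le_anti/andP.
  rewrite -addn1 /join_prime_count.
  rewrite -[X in (X <= _)%N](cardsID [set p | join_prime e p & (p <= v)%O]).
  apply: leq_add sub1; exact: subset_leq_card (subsetIr _ _).
elim/ltn_ind: {u}(f u) {-2}u (erefl (f u)) => m IH u fu.
case: (eqVneq u e) => [->|ue]; first by rewrite fe.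
have [v vu fv] := f_down u ue.
apply: leq_trans fv _.
apply: leq_ltn_trans (cnt_lt _ _ vu); apply: (IH (f v)) => //; rewrite -fu; exact: f_lt.
Qed.
End DistrLattice.

(** * Boolean multichains *)

Lemma card_tuple_cons (T : finType) l (P : pred (seq T)) :
  #|[set t : l.+1.-tuple T | P t]| =
  \sum_(x : T) #|[set t : l.-tuple T | P (x :: t)]|.
Proof.
rewrite -sum1dep_card.
rewrite (reindex (fun p : T * l.-tuple T => [tuple of p.1 :: p.2])) /=; last first.
  exists (fun t : l.+1.-tuple T => (thead t, [tuple of behead t])) => [[a t]|t] _ /=.
    by congr pair; apply/val_inj.
  by apply/val_inj; case: t => [[|x t]].
rewrite -(pair_big_dep xpredT (fun x (t : l.-tuple T) => P (x :: t)) (fun _ _ => 1)) /=.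
by apply: eq_bigr => x _; rewrite sum1dep_card.
Qed.

Section BooleanChains.
Local Open Scope order_scope.
Variables (d : Order.disp_t) (L : finDistrLatticeType d).
Implicit Types x y z c : L.

Lemma boolean_itvP x y :
  reflect (x <= y /\ forall a, x <= a <= y ->
             exists b, [/\ x <= b <= y, a `&` b = x & a `|` b = y])
          (boolean_itv x y).
Proof.
apply: (iffP and3P) => [[xy _ /forall_inP H]|[xy H]].
  split=> // a axy; have := H a; rewrite inE axy => /(_ isT) /exists_inP[b].
  by rewrite inE => bxy /andP[/eqP ? /eqP ?]; exists b.
split=> //.
  apply/forall_inP => a _; apply/forall_inP => b _; apply/forall_inP => u _.
  by rewrite meetUr.
apply/forall_inP => a; rewrite inE => /H[b [bxy h1 h2]].
by apply/exists_inP; exists b; rewrite ?inE ?bxy // h1 h2 !eqxx.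
Qed.

Lemma boolean_itv_le x y : boolean_itv x y -> x <= y.
Proof. by case/boolean_itvP. Qed.

Lemma boolean_itvxx x : boolean_itv x x.
Proof.
apply/boolean_itvP; split=> // a /le_anti <-; exists x.
by rewrite lexx meetxx joinxx.
Qed.

(** Trivial steps are allowed, as [boolean_itv x x] holds; this makes the count multiplicative over
    products. *)
Fixpoint boolean_multichains k x y : nat :=
  if k is k'.+1 then \sum_(z | boolean_itv x z) boolean_multichains k' z y
  else x == y.

Lemma boolean_multichains_recr k x y :
  boolean_multichains k.+1 x y =
  \sum_(z | boolean_itv z y) boolean_multichains k x z.
Proof.
elim: k x => [|k IH] x.
  have E (P : pred L) a : \sum_(z | P z) (z == a) = P a.
    rewrite big_mkcond (bigD1 a) //= eqxx big1 ?addn0 => [|z /negPf ->]; first by case: (P a).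
    exact: if_same.
  by rewrite /= E; under eq_bigr do rewrite eq_sym; rewrite (E (fun z => boolean_itv z y)).
transitivity (\sum_(z | boolean_itv x z) boolean_multichains k.+1 z y) => //.
under eq_bigr do rewrite IH.
rewrite (exchange_big_dep (fun z => boolean_itv z y)) //=.
by apply: eq_bigr => z zy; apply: eq_bigl => u; rewrite zy andbT.
Qed.

Lemma boolean_multichains_le k x y : boolean_multichains k x y != 0 -> x <= y.
Proof.
elim: k x => [|k IH] x /=; first by case: (eqVneq x y) => [->|].
apply: contraR => nxy; rewrite big1 // => z xz; apply/eqP.
by apply: contraR nxy => /IH; apply: le_trans; apply: boolean_itv_le.
Qed.

Lemma boolean_multichains_diag k e : (forall x, e <= x) ->
  boolean_multichains k e e = 1.
Proof.
move=> e_le; elim: k => [|k IH] /=; first by rewrite eqxx.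
rewrite (bigD1 e) ?boolean_itvxx //= IH big1 // => z /andP[_ ze].
apply/eqP; apply: contraNT ze => /boolean_multichains_le ze.
by rewrite eq_le ze e_le.
Qed.

Section Product.
Variables c c' e : L.
Hypotheses (e_le : forall x, e <= x) (cc' : c `&` c' = e).

Let eU x : e `|` x = x. Proof. exact/join_r. Qed.
Let Ue x : x `|` e = x. Proof. exact/join_l. Qed.
Let split_meet x : x <= c `|` c' -> x = (x `&` c) `|` (x `&` c').
Proof. by move=> h; rewrite -meetUr; apply/esym/meet_l. Qed.
Let disjoint_meet u v : u <= c -> v <= c' -> u `&` v = e.
Proof. by move=> uc vc; apply/le_anti; rewrite e_le andbT -cc' leI2. Qed.
Let join_meetl u v : u <= c -> v <= c' -> (u `|` v) `&` c = u.
Proof.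
by move=> uc vc; rewrite meetUl (meet_l uc) [v `&` c]meetC disjoint_meet ?Ue.
Qed.
Let join_meetr u v : u <= c -> v <= c' -> (u `|` v) `&` c' = v.
Proof. by move=> uc vc; rewrite meetUl (meet_l vc) disjoint_meet ?eU. Qed.

Lemma boolean_itv_prod x y : x <= c `|` c' -> y <= c `|` c' ->
  boolean_itv x y =
  boolean_itv (x `&` c) (y `&` c) && boolean_itv (x `&` c') (y `&` c').
Proof.
move=> xt yt; apply/idP/andP.
  case/boolean_itvP => xy H.
  have half c1 c2 : c1 `|` c2 = c `|` c' -> c1 `&` c2 = e ->
      boolean_itv (x `&` c1) (y `&` c1).
    move=> U12 I12.
    have xE z : z <= c `|` c' -> (z `&` c1) `|` (z `&` c2) = z.
      by move=> zt; rewrite -meetUr U12; apply: meet_l.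
    apply/boolean_itvP; split=> [|a /andP[xa ay]]; first exact: leI2.
    have ac1 : a <= c1 := le_trans ay (leIr _ _).
    have dj u v : u <= c2 -> v <= c1 -> u `&` v = e.
      by move=> uc vc; apply/le_anti; rewrite e_le andbT -I12 meetC leI2.
    (* [a] is padded with the [c2]-part of [x] to land in the full interval; the complement found
       there is then cut down to [c1]. *)
    have [|b [/andP[xb yb] ab1 ab2]] := H (a `|` (x `&` c2)).
      apply/andP; split; first by rewrite -[X in X <= _]xE // leU2.
      by rewrite leUx (le_trans ay (leIl _ _)) (le_trans (leIl _ _) xy).
    exists (b `&` c1); split; first by rewrite !leI2.
      by rewrite -[in RHS]ab1 -[in RHS]meetA meetUl [X in _ `|` X]dj ?leIr // Ue.
    by rewrite -[in RHS]ab2 !meetUl [X in _ `|` X `|` _]dj ?leIr // Ue (meet_l ac1).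
  split; first exact: (half c c').
  by apply: (half c' c); rewrite ?[c' `|` c]joinC // meetC.
case=> /boolean_itvP[xy1 H1] /boolean_itvP[xy2 H2]; apply/boolean_itvP.
rewrite [x in x <= y]split_meet // [y in _ <= y]split_meet // leU2 //.
split=> // a /andP[xa ay]; have at_ := le_trans ay yt.
have [|b1 [/andP[xb1 by1] I1 U1]] := H1 (a `&` c); first by rewrite !leI2.
have [|b2 [/andP[xb2 by2] I2 U2]] := H2 (a `&` c'); first by rewrite !leI2.
have b1c : b1 <= c := le_trans by1 (leIr _ _).
have b2c : b2 <= c' := le_trans by2 (leIr _ _).
have aE := split_meet at_.
exists (b1 `|` b2); split.
- by rewrite [x]split_meet // [y]split_meet // !leU2.
- rewrite [x]split_meet // -I1 -I2 [a in LHS]aE meetUl !meetUr.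
  rewrite [a `&` c `&` b2]disjoint_meet ?leIr // Ue.
  by rewrite [a `&` c' `&` b1]meetC [b1 `&` (a `&` c')]disjoint_meet ?leIr // eU.
rewrite [y]split_meet // -U1 -U2 [a in LHS]aE.
by rewrite joinACA.
Qed.

Lemma boolean_multichains_prod k x : x <= c `|` c' ->
  boolean_multichains k x (c `|` c') =
  boolean_multichains k (x `&` c) c * boolean_multichains k (x `&` c') c'.
Proof.
elim: k x => [|k IH] x xt /=.
  rewrite mulnb; congr nat_of_bool; apply/eqP/andP => [->|[/eqP h1 /eqP h2]].
    by split; apply/eqP/meet_r; rewrite (leUl, leUr).
  by rewrite [x]split_meet // h1 h2.
rewrite (bigID (fun z => z <= c `|` c')) /= [X in _ + X]big1 ?addn0; last first.
  move=> z /andP[_ nz]; apply/eqP; apply: contraNT nz.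
  exact: boolean_multichains_le.
rewrite (eq_bigr (fun z => boolean_multichains k (z `&` c) c *
   boolean_multichains k (z `&` c') c')); last by move=> z /andP[_ /IH].
have restrict c1 (x1 : L) : x1 <= c1 ->
    \sum_(z | boolean_itv x1 z) boolean_multichains k z c1 =
    \sum_(z | boolean_itv x1 z && (z <= c1)) boolean_multichains k z c1.
  move=> _; rewrite (bigID (fun z => z <= c1)) /= [X in _ + X]big1 ?addn0 //.
  move=> z /andP[_ nz]; apply/eqP; apply: contraNT nz.
  exact: boolean_multichains_le.
rewrite !restrict ?leIr // big_distrl /=.
under [RHS]eq_bigr do rewrite big_distrr /=.
rewrite pair_big_dep /=.
rewrite [LHS](reindex_onto (fun p : L * L => p.1 `|` p.2)
                      (fun z => (z `&` c, z `&` c'))) /=; last first.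
  by move=> z /andP[_ zt]; rewrite -split_meet.
apply: eq_big => [[u v]|[u v] /=] /=.
  apply/andP/andP => [[/andP[xuv uvt] /eqP[uE vE]]|[/andP[xu uc] /andP[xv vc]]].
    have uc : u <= c by rewrite -uE leIr.
    have vc : v <= c' by rewrite -vE leIr.
    by move: xuv; rewrite boolean_itv_prod // uE vE uc vc => /andP[-> ->].
  by rewrite boolean_itv_prod ?leU2 // !join_meetl // !join_meetr // xu xv !eqxx.
by case/andP=> _ /eqP[-> ->].
Qed.
End Product.

Definition strict_boolean x y := (x < y) && boolean_itv x y.

Fixpoint strict_boolean_chains l x y : nat :=
  if l is l'.+1 then \sum_(z | strict_boolean x z) strict_boolean_chains l' z y
  else x == y.

(* The step relation of [boolean_multichains] is the strict one plus the identity, so each strict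
   step is a difference in [k]. *)
Lemma strict_boolean_chains_alt l x y :
  (strict_boolean_chains l x y)%:Z%R =
  (\sum_(k < l.+1) (-1) ^+ (l - k) * 'C(l, k)%:Z
     * (boolean_multichains k x y)%:Z)%R.
Proof.
(* [sb l k x] counts [l] strict boolean steps from [x] followed by a multichain of [k] steps to [y].
   In [sbS] the first multichain step is either strict or trivial. *)
pose fix sb l k x {struct l} : int :=
  if l is l'.+1 then (\sum_(z | strict_boolean x z) sb l' k z)%R
  else (boolean_multichains k x y)%:Z%R.
have sbS l' k x' : sb l'.+1 k x' = (sb l' k.+1 x' - sb l' k x')%R.
  elim: l' x' => [|l' IH] x'.
    rewrite /= [in RHS](bigD1 x') ?boolean_itvxx //= PoszD addrC addKr.
    rewrite [RHS](big_morph Posz PoszD (erefl _)).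
    by apply: eq_bigl => z; rewrite /strict_boolean lt_neqAle eq_sym;
      case: (boolP (boolean_itv x' z)) => [/boolean_itv_le ->|_]; rewrite ?andbT ?andbF.
  rewrite -[LHS]/(\sum_(z | strict_boolean x' z) sb l'.+1 k z)%R.
  under eq_bigr do rewrite IH.
  by rewrite sumrB.
have sb0 l' x' : sb l' 0 x' = (strict_boolean_chains l' x' y)%:Z%R.
  elim: l' x' => // l' IH x' /=; under eq_bigr do rewrite IH.
  by rewrite -(big_morph Posz PoszD (erefl _)).
suff sbE l' k x' : sb l' k x' = (\sum_(j < l'.+1) (-1) ^+ (l' - j) * 'C(l', j)%:Z
     * (boolean_multichains (k + j) x' y)%:Z)%R by rewrite -sb0 sbE.
elim: l' k x' => [|l' IH] k x'.
  by rewrite big_ord1 /= addn0 expr0 !mul1r.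
rewrite sbS !IH.
have -> : (- (\sum_(j < l'.+1) (-1) ^+ (l' - j) * 'C(l', j)%:Z
                 * (boolean_multichains (k + j) x' y)%:Z) =
   \sum_(j < l'.+2) (-1) ^+ (l'.+1 - j) * 'C(l', j)%:Z * (boolean_multichains (k + j) x' y)%:Z)%R.
  rewrite [RHS]big_ord_recr /= (@bin_small l' l'.+1) // mulr0 mul0r addr0 -sumrN.
  by apply: eq_bigr => j _; rewrite subSn -1?ltnS // exprS mulN1r !mulNr.
rewrite [X in (_ + X)%R]big_ord_recl [RHS]big_ord_recl /= addrCA -big_split /=.
congr (_ + _)%R; first by rewrite !bin0.
apply: eq_bigr => i _; rewrite /bump /= add1n ?addSn ?addnS subSS binS PoszD; ring.
Qed.

Lemma card_strict_boolean_chains l x y :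
  #|[set t : l.-tuple L | path strict_boolean x t & last x t == y]| =
  strict_boolean_chains l x y.
Proof.
elim: l x => [|l IH] x.
  rewrite /=; case: (eqVneq x y) => xy.
    rewrite (_ : [set _ | _] = [set [tuple]]) ?cards1 //.
    by apply/setP => t; rewrite !inE tuple0 /= xy eqxx.
  apply/eqP; rewrite cards_eq0; apply/eqP/setP => t.
  by rewrite !inE tuple0 /= (negPf xy).
rewrite (card_tuple_cons l (fun s => path strict_boolean x s && (last x s == y))) /=.
rewrite [RHS]big_mkcond /=; apply: eq_bigr => z _; case: ifP => xz.
  by rewrite -IH; apply: eq_card => t; rewrite !inE.
by apply/eqP; rewrite cards_eq0; apply/eqP/setP => t; rewrite !inE.
Qed.

(** A strictly increasing sequence containing the least and the greatest element begins with the one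
    and ends with the other. *)
Lemma card_boolean_chains l e t : (forall x, e <= x) -> (forall x, x <= t) ->
  #|boolean_chains L l| = strict_boolean_chains l e t.
Proof.
move=> e_le t_ge; rewrite -card_strict_boolean_chains.
rewrite (card_tuple_cons l (fun s => boolean_chain s)) (bigD1 e) //= [X in _ + X]big1 ?addn0.
  apply: eq_card => s; rewrite !inE /boolean_chain /=.
  have -> : path strict_boolean e s = path <%O e s && path (@boolean_itv d L) e s.
    elim: (tval s) (e) => //= a s' IH b; rewrite IH /strict_boolean.
    by rewrite andbACA.
  case: (boolP (path <%O e s)) => //= es.
  have -> /= : [exists z in e :: s, forall y, z <= y].
    apply/exists_inP; exists e; first by rewrite inE eqxx.
    exact/forallP.
  rewrite andbC; congr andb; apply/exists_inP/eqP => [[z zs /forallP zmax]|tE].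
    have zt : z = t by apply/le_anti; rewrite t_ge zmax.
    rewrite -{}zt in zmax *.
    apply/le_anti; rewrite zmax /=.
    case/splitPl: zs es => p q <-; rewrite cat_path last_cat => /andP[_].
    elim: q (last e p) => //= a q IH b /andP[ab /IH]; apply: le_trans; exact: ltW.
  exists t; first by rewrite -tE; exact: mem_last.
  exact/forallP.
move=> x xe; apply/eqP; rewrite cards_eq0; apply/eqP/setP => s; rewrite !inE.
apply/negP => /and4P[/= xs /exists_inP[z zs /forallP zmin] _ _].
have zx : z = x.
  move: zs; rewrite inE => /orP[/eqP //|zs].
  have := allP (order_path_min lt_trans xs) z zs => /lt_geF.
  by rewrite zmin.
by case/eqP: xe; apply/le_anti; rewrite -{1}zx zmin e_le.
Qed.
End BooleanChains.

(** * Strict fillings of a box *)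

Section Box.
Local Open Scope ring_scope.

(* The binomial coefficient with an integer upper index: (-m-1 choose d) = (-1)^d (m+d choose d). *)
Definition binz (m : int) (d : nat) : int :=
  match m with
  | Posz m => 'C(m, d)%:Z
  | Negz m => (-1) ^+ d * 'C(m + d, d)%:Z
  end.

Lemma binz0 m : binz m 0 = 1.
Proof. by case: m => m; rewrite /= ?addn0 bin0 ?mul1r. Qed.

Lemma binz_pascal m d : binz (m + 1) d.+1 = binz m d.+1 + binz m d.
Proof.
case: m => m; first by rewrite -PoszD addn1 /= binS.
case: m => [|m].
  rewrite (_ : Negz 0 + 1 = 0) //= !add0n !binn bin_small // exprS; ring.
rewrite (_ : Negz m.+1 + 1 = Negz m) /=; last by lia.
by rewrite [(m.+1 + d.+1)%N]addSn binS addSnnS PoszD exprS; ring.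
Qed.

Variables (a b : nat).
Implicit Types lam mu : {ffun 'I_a -> 'I_b.+1}.

Definition box_partition lam :=
  [forall i : 'I_a, forall j : 'I_a, (i <= j)%N ==> (lam j <= lam i)%N].

(** For partitions, at most one new cell in each row and in each column: the added cells form an
    antichain. *)
Definition box_step lam mu :=
  [forall i, (lam i <= mu i <= (lam i).+1)%N] &&
  [forall i : 'I_a, forall j : 'I_a, (i < j)%N ==> (mu j <= lam i)%N].

(** Labelling each cell by the step at which it appears turns these chains into fillings of [mu] by
    1 to [k], strictly increasing along rows and columns. *)
Fixpoint box_chains k mu : nat :=
  if k is k'.+1
  then (\sum_(lam | box_partition lam && box_step lam mu) box_chains k' lam)%N
  else mu == [ffun=> ord0].

(** A Jacobi-Trudi type entry. Rows with [i > k] occur, so the upper index may be negative, where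
    [binz] keeps the Pascal rule; the guard makes a negative lower index give 0. *)
Definition box_entry k m i j : int :=
  if (i <= m + j)%N then binz (k%:Z - i%:Z) (m + j - i) else 0.

Lemma box_entry_pascal k m i j :
  box_entry k.+1 m i j = box_entry k m i j + box_entry k.+1 m i.+1 j.
Proof.
rewrite /box_entry; case: (ltngtP i (m + j)%N) => [lt|gt|->]; last by rewrite subnn !binz0 addr0.
  rewrite -(subnK (ltnW lt)) [(_ - i + i)%N]addnC addKn.
  have -> : (m + j - i = (m + j - i.+1).+1)%N by lia.
  have -> : k.+1%:Z - i%:Z = (k%:Z - i%:Z) + 1 by lia.
  by rewrite binz_pascal; congr (_ + binz _ _); lia.
by rewrite addr0.
Qed.

Lemma box_entry_shift k m i j : box_entry k.+1 m.+1 i.+1 j = box_entry k m i j.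
Proof.
rewrite /box_entry addSn ltnS subSS; case: ifP => // _; congr binz; lia.
Qed.

Section Step.
Variable mu : {ffun 'I_a -> 'I_b.+1}.
Hypothesis mu_part : box_partition mu.

Let mu_mono (i j : 'I_a) : (i <= j)%N -> (mu j <= mu i)%N.
Proof. by move: mu_part => /forallP/(_ i)/forallP/(_ j)/implyP. Qed.

Definition tied (i : 'I_a) := [exists j : 'I_a, (j == i.+1 :> nat) && (mu j == mu i)].

Definition row_choice (i : 'I_a) : pred 'I_b.+1 :=
  [pred x | (x == mu i) || ((x.+1 == mu i :> nat) && ~~ tied i)].

(** For fixed [mu] the constraints decouple: each row keeps its length or loses one cell, and the
    obstruction from an equal next row depends on [mu] alone. This product form allows summing a
    determinant row by row. *)
Lemma box_step_family lam :
  (box_partition lam && box_step lam mu) = (lam \in family row_choice).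
Proof.
apply/idP/familyP.
  case/and3P=> _ /forallP s1 /forallP s2 i; rewrite inE.
  have /andP[l1 l2] := s1 i.
  case: (eqVneq (lam i) (mu i)) => //= ne.
  have ne' : (lam i : nat) <> mu i by move=> h; case/eqP: ne; apply/val_inj.
  apply/andP; split; first by lia.
  apply/existsP => -[j /andP[/eqP ji /eqP mji]].
  have /forallP/(_ j)/implyP := s2 i; rewrite ji ltnSn mji => /(_ isT); lia.
move=> H.
have sub (i j : 'I_a) : (i < j)%N -> (mu j <= lam i)%N.
  move=> ij; have := H i; rewrite inE => /orP[/eqP ->|/andP[/eqP lE nt]].
    exact/mu_mono/ltnW.
  have i1a : (i.+1 < a)%N by apply: leq_ltn_trans ij (ltn_ord j).
  pose i1 := Ordinal i1a.
  have h1 : (mu j <= mu i1)%N by apply: mu_mono.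
  have h2 : (mu i1 <= mu i)%N by apply: mu_mono => /=.
  have h3 : (mu i1 : nat) <> mu i.
    by move=> e; case/existsP: nt; exists i1; rewrite eqxx /=; apply/eqP/val_inj.
  by apply: leq_trans h1 _; rewrite -ltnS lE ltn_neqAle h2 andbT; apply/eqP.
have le i : (lam i <= mu i <= (lam i).+1)%N.
  have := H i; rewrite inE => /orP[/eqP ->|/andP[/eqP <- _]]; by rewrite !leqnn leqnSn.
apply/and3P; split.
- apply/forallP => i; apply/forallP => j; apply/implyP.
  rewrite leq_eqVlt => /orP[/eqP/val_inj -> //|ij].
  have := sub _ _ ij; have := le j; lia.
- exact/forallP.
by apply/forallP => i; apply/forallP => j; apply/implyP; apply: sub.
Qed.

Lemma row_choice_sum k (i j : 'I_a) :
  \sum_(x | row_choice i x) box_entry k x i j =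
  box_entry k.+1 (mu i) i j - (tied i)%:R * box_entry k.+1 (mu i) i.+1 j.
Proof.
rewrite (bigD1 (mu i)) /=; last by rewrite /row_choice /= eqxx.
case: (boolP (tied i)) => t.
  rewrite mul1r big1 => [|x]; first by rewrite box_entry_pascal; ring.
  by rewrite /row_choice /= t andbF orbF; case: eqP.
rewrite mul0r subr0 box_entry_pascal; congr (_ + _).
(* When [mu i = 0] no cell can be removed, so the remaining entry must vanish: an untied zero row is
   the last row, whence [j <= i]. *)
case: (posnP (mu i)) => [m0|m_gt0].
  rewrite big1 => [|x]; last by rewrite /row_choice /= m0 andFb orbF; case: eqP.
  rewrite m0 /box_entry add0n ltnNge; case: leqP => // ij.
  have i1a : (i.+1 < a)%N by apply: leq_ltn_trans ij (ltn_ord j).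
  case/existsP: t; exists (Ordinal i1a); rewrite eqxx /=; apply/eqP/val_inj => /=.
  have : (mu (Ordinal i1a) <= mu i)%N by apply: mu_mono => /=.
  by rewrite m0; lia.
have lt : ((mu i).-1 < b.+1)%N by apply: leq_ltn_trans (leq_pred _) (ltn_ord _).
rewrite (big_pred1 (Ordinal lt)) /=.
  by rewrite -{2}(prednK m_gt0) box_entry_shift.
move=> x; rewrite /row_choice /= t andbT -!val_eqE /=; lia.
Qed.
End Step.

(* The sum over [lam] is multilinear in the rows. When [mu i = mu (i + 1)], row [i] must not grow,
   and its sum is row [i] at time [k + 1] minus row [i + 1] at time [k + 1]: a unitriangular
   change of rows. *)
Lemma det_box_entry_sum k mu : box_partition mu ->
  \sum_(lam | box_partition lam && box_step lam mu)
     \det (\matrix_(i < a, j < a) box_entry k (lam i) i j) =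
  \det (\matrix_(i < a, j < a) box_entry k.+1 (mu i) i j).
Proof.
move=> mu_part; rewrite (eq_bigl _ _ (box_step_family mu_part)).
pose full : 'M[int]_a := \matrix_(i < a, j < a) box_entry k.+1 (mu i) i j.
pose T : 'M[int]_a :=
  \matrix_(i < a, j < a) ((i == j)%:R - (tied mu i && (j == i.+1 :> nat))%:R).
have detT : \det T = 1.
  rewrite -det_tr det_trig.
    rewrite big1 // => i _; rewrite !mxE eqxx (_ : (_ == _.+1) = false) ?andbF ?subr0 //.
    by apply/eqP; lia.
  apply/is_trig_mxP => i j ij; rewrite !mxE.
  have -> : (j == i) = false by apply/eqP => e; move: ij; rewrite e ltnn.
  have -> : (i == j.+1 :> nat) = false by apply/eqP; lia.
  by rewrite andbF subr0.
rewrite -/full -[RHS]mul1r -detT -det_mulmx.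
have -> : T *m full = \matrix_(i < a, j < a)
    \sum_(x | row_choice mu i x) box_entry k x i j.
  apply/matrixP => i j; rewrite !mxE row_choice_sum //.
  under eq_bigr do rewrite !mxE mulrBl.
  rewrite sumrB (bigD1 i) //= eqxx mul1r [X in _ + X - _]big1 ?addr0; last first.
    by move=> s /negPf si; rewrite eq_sym si mul0r.
  congr (_ - _); case: (boolP (tied mu i)) => [|_]; last first.
    by rewrite mul0r big1 // => s _; rewrite mul0r.
  case/existsP => s /andP[/eqP si /eqP ms].
  rewrite (bigD1 s) //=. rewrite si eqxx ms /= !mul1r big1 ?addr0 // => s' ss'.
  rewrite (_ : (_ == _) = false) ?mul0r //; apply/eqP => e.
  by case/eqP: ss'; apply/val_inj; rewrite /= e si.
rewrite /determinant exchange_big /=; apply: eq_bigr => s _.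
rewrite -big_distrr /=; congr (_ * _).
rewrite (eq_bigr (fun i => \sum_(x | row_choice mu i x) box_entry k x i (s i))); last first.
  by move=> i _; rewrite mxE.
rewrite bigA_distr_big_dep /=; apply: eq_bigr => lam _.
by apply: eq_bigr => i _; rewrite mxE.
Qed.

Lemma box_chains_det k mu : box_partition mu ->
  (box_chains k mu)%:Z = \det (\matrix_(i < a, j < a) box_entry k (mu i) i j).
Proof.
elim: k mu => [|k IH] mu mu_part; last first.
  rewrite -det_box_entry_sum //= (big_morph Posz PoszD (erefl _)).
  by apply: eq_bigr => lam /andP[/IH].
rewrite /=; case: eqP => [->|ne].
  rewrite -det_tr det_trig.
    rewrite big1 // => i _; rewrite !mxE ffunE /= /box_entry add0n leqnn subnn.
    by rewrite binz0.
  apply/is_trig_mxP => i j ij; rewrite !mxE ffunE /box_entry add0n leqNgt.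
  by rewrite ij.
have [i0 i0P] : exists i : 'I_a, (0 < mu i)%N.
  apply/existsP; apply: contra_notT ne; rewrite negb_exists => /forallP H.
  apply/ffunP => i; rewrite ffunE; apply/val_inj => /=; have := H i; lia.
have a0 : (0 < a)%N by apply: leq_ltn_trans (ltn_ord i0).
pose o := Ordinal a0.
have mo : (0 < mu o)%N.
  apply: leq_trans i0P _; move: mu_part => /forallP/(_ o)/forallP/(_ i0)/implyP; exact.
(* Row 0 vanishes: its entries are ['C(0, mu o + j)] with [mu o] positive. *)
rewrite (expand_det_row _ o) big1 // => j _; rewrite mxE /box_entry /= subn0.
by rewrite bin_small ?mul0r // addn_gt0 mo.
Qed.
End Box.

(** * The determinant at the full rectangle *)

Section BoxFull.
Local Open Scope ring_scope.

(** Vandermonde's convolution is an LU factorisation with both factors unitriangular. *)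
Lemma det_bin_shift (a b : nat) :
  \det (\matrix_(i < a, j < a) ('C(b + j, i)%:Z : int)) = 1.
Proof.
pose L : 'M[int]_a := \matrix_(i, j) (if (j <= i)%N then 'C(b, i - j)%:Z else 0).
pose U : 'M[int]_a := \matrix_(i, j) 'C(j, i)%:Z.
have -> : \matrix_(i < a, j < a) ('C(b + j, i)%:Z : int) = L *m U.
  apply/matrixP => i j; rewrite !mxE addnC -binomial.Vandermonde.
  rewrite (big_morph Posz PoszD (erefl _)).
  rewrite (big_ord_widen a (fun l => ('C(j, l) * 'C(b, i - l))%:Z)) //.
  rewrite big_mkcond; apply: eq_bigr => l _; rewrite !mxE ltnS.
  by case: ifP => _; rewrite ?mul0r // PoszM mulrC.
rewrite det_mulmx det_trig; last first.
  by apply/is_trig_mxP => i j ij; rewrite mxE leqNgt ij.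
rewrite -[X in _ * X]det_tr [X in _ * X]det_trig; last first.
  by apply/is_trig_mxP => i j ij; rewrite !mxE bin_small.
by rewrite !big1 ?mul1r // => i _; rewrite !mxE ?leqnn ?subnn ?bin0 ?binn.
Qed.

(** In factorials, the entry times its column factor is its row factor times ['C(b + j, i)]. The
    bound keeps the subtractions [k - b - j] from truncating. *)
Lemma det_box_full (a b k : nat) : (a + b <= k.+1)%N ->
  \det (\matrix_(i < a, j < a) box_entry k b i j) *
    (\prod_(j < a) ((k - b - j)`! * (b + j)`!)%N%:Z) =
  (\prod_(i < a) ((k - i)`! * i`!)%N%:Z) :> int.
Proof.
move=> abk.
pose c : 'rV[int]_a := \row_j ((k - b - j)`! * (b + j)`!)%N%:Z.
pose r : 'rV[int]_a := \row_i ((k - i)`! * i`!)%N%:Z.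
rewrite (_ : \prod_(j < a) _ = \det (diag_mx c)); last first.
  by rewrite det_diag; apply: eq_bigr => j _; rewrite mxE.
rewrite [RHS](_ : \prod_(i < a) _ = \det (diag_mx r)); last first.
  by rewrite det_diag; apply: eq_bigr => j _; rewrite mxE.
rewrite -[RHS]mulr1 -(det_bin_shift a b) -!det_mulmx; congr (\det _).
apply/matrixP => i j; rewrite mul_mx_diag mul_diag_mx !mxE /box_entry.
have [ia ja] := (ltn_ord i, ltn_ord j).
case: leqP => ij; last by rewrite bin_small // mulr0 mul0r.
rewrite subzn /=; last by lia.
rewrite -!PoszM; congr Posz.
rewrite -[in RHS]mulnA [(i`! * _)%N]mulnC.
have h1 : ('C(k - i, b + j - i) * ((b + j - i)`! * (k - b - j)`!) = (k - i)`!)%N.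
  have -> : (k - b - j = k - i - (b + j - i))%N by lia.
  by apply: bin_fact; lia.
by rewrite -h1 -(bin_fact ij); ring.
Qed.

(** The last cell of row [i] ends a strictly increasing path of [mu i + i] cells from the corner,
    and only [k] labels exist. *)
Lemma box_chains_support (a b k : nat) (mu : {ffun 'I_a -> 'I_b.+1}) (i : 'I_a) :
  box_chains k mu != 0%N -> (0 < mu i)%N -> (mu i + i <= k)%N.
Proof.
elim: k mu i => [|k IH] mu i /=.
  by case: (eqVneq mu _) => // -> _; rewrite ffunE.
move=> nz mi.
have /existsP[lam /andP[/andP[_ /andP[/forallP s1 /forallP s2]] lnz]] :
    [exists lam, (box_partition lam && box_step lam mu) && (box_chains k lam != 0%N)].
  apply: contraR nz; rewrite negb_exists => /forallP H; rewrite big1 // => lam lP.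
  by have := H lam; rewrite lP negbK => /eqP.
case: (posnP i) => i0.
  have /andP[l1 l2] := s1 i; rewrite i0 addn0; apply: leq_trans l2 _; rewrite ltnS.
  case: (posnP (lam i)) => [-> //|l_gt0].
  by have := IH lam i lnz l_gt0; rewrite i0 addn0.
have lt : (i.-1 < a)%N := leq_ltn_trans (leq_pred i) (ltn_ord i).
have [o oE] : {o : 'I_a | o.+1 = i} by exists (Ordinal lt); rewrite /= prednK.
have /forallP/(_ i)/implyP := s2 o; rewrite -oE leqnn => /(_ isT) h.
have := IH lam o lnz (leq_trans mi h); rewrite addnS ltnS.
by apply: leq_trans; rewrite leq_add2r.
Qed.

(* MacMahon's count of strict fillings of a rectangle, multiplied out. *)
Lemma box_chains_full (a b k : nat) : (0 < a)%N -> (0 < b)%N ->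
  (box_chains k ([ffun=> ord_max] : {ffun 'I_a -> 'I_b.+1}) *
     (\prod_(i < a) 'C(k, i) * \prod_(i < b) 'C(k, i)) =
   \prod_(i < a + b) 'C(k, i))%N.
Proof.
(* For [a + b > k + 1] both sides are 0: the factor ['C(k, a + b - 1)] vanishes, and the last row
   cannot reach length [b] in [k] steps. *)
move=> a0 b0; case: (leqP (a + b) k.+1) => abk; last first.
  have lt : ((a + b).-1 < a + b)%N by lia.
  rewrite [RHS](bigD1 (Ordinal lt)) //= bin_small ?mul0n; last by lia.
  have lta : (a.-1 < a)%N by lia.
  apply/eqP; rewrite muln_eq0; apply/orP; left; apply: contraTT abk => nz.
  have := box_chains_support (i := Ordinal lta) nz; rewrite ffunE /=; lia.
rewrite [(a + b)%N]addnC big_split_ord /= [RHS]mulnC mulnA; congr muln.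
have part : box_partition ([ffun=> ord_max] : {ffun 'I_a -> 'I_b.+1}).
  by apply/forallP => i; apply/forallP => j; rewrite !ffunE leqnn implybT.
apply/eqP; rewrite -eqz_nat PoszM (box_chains_det k part).
pose c := (\prod_(j < a) ((k - b - j)`! * (b + j)`!))%N.
have c_gt0 : (0 < c)%N by apply: prodn_gt0 => j; rewrite muln_gt0 !fact_gt0.
have cE : c%:Z = \prod_(j < a) ((k - b - j)`! * (b + j)`!)%N%:Z.
  exact: (big_morph Posz PoszM (erefl _)).
have c_neq0 : c%:Z != 0 by rewrite eqz_nat -lt0n.
apply/eqP/(mulIf c_neq0); rewrite mulrAC.
(* After multiplication by [c], a binomial completes each pair of factorials to [k!] on both
   sides. *)
transitivity (\prod_(i < a) (k`!)%:Z).
  rewrite (_ : \matrix_(i, j) _ = \matrix_(i < a, j < a) box_entry k b i j); last first.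
    by apply/matrixP => i j; rewrite !mxE ffunE.
  rewrite cE det_box_full // (big_morph Posz PoszM (erefl _)) -big_split /=.
  apply: eq_bigr => i _; rewrite -PoszM; congr Posz.
  by rewrite mulnC [((k - i)`! * _)%N]mulnC bin_fact //; have := ltn_ord i; lia.
rewrite cE (big_morph Posz PoszM (erefl _)) -big_split /=.
apply: eq_bigr => i _; rewrite -PoszM; congr Posz.
by rewrite -subnDA [((k - _)`! * _)%N]mulnC bin_fact //; have := ltn_ord i; lia.
Qed.
End BoxFull.

(** * Positions of values and the two orders *)

Section Positions.
Variable n : nat.
Implicit Types (v w : 'S_n) (f : nat -> nat).

(* The position of a value, extended by the identity to all natural numbers. *)
Definition posn w (a : nat) : nat :=
  if insub a is Some i then (w^-1)%g (i : 'I_n) else a.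

Lemma posnE w (i : 'I_n) : posn w i = (w^-1)%g i.
Proof. by rewrite /posn valK. Qed.

Lemma posn_out w a : n <= a -> posn w a = a.
Proof. by move=> h; rewrite /posn insubN // -leqNgt. Qed.

Lemma posn_lt w a : (posn w a < n) = (a < n).
Proof.
rewrite /posn; case: insubP => [i -> ai|/negPf ->]; first by rewrite ltn_ord.
by [].
Qed.

Lemma posn_inj w : injective (posn w).
Proof.
move=> a b; case: (ltnP a n) => an; case: (ltnP b n) => bn.
- rewrite -[a]/(val (Ordinal an)) -[b]/(val (Ordinal bn)) !posnE.
  by move/val_inj/perm_inj => ->.
- by move=> e; have := posn_lt w a; rewrite e posn_out // an ltnNge bn.
- by move=> e; have := posn_lt w b; rewrite -e posn_out // bn ltnNge an.
by rewrite !posn_out.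
Qed.

Lemma posn_ext v w : (forall a, a < n -> posn v a = posn w a) -> v = w.
Proof.
move=> h; apply: invg_inj; apply/permP => i; apply/val_inj.
by have := h i (ltn_ord i); rewrite !posnE.
Qed.

Lemma posn1 a : posn 1 a = a.
Proof.
case: (ltnP a n) => an; last by rewrite posn_out.
by rewrite -[a in LHS]/(val (Ordinal an)) posnE invg1 perm1.
Qed.

Definition pos_fun f :=
  [/\ forall a, a < n -> f a < n, forall a, n <= a -> f a = a & injective f].

Definition mkpos f : 'S_n :=
  ((insubd (1%g : 'S_n) [ffun i : 'I_n => insubd i (f i)])^-1)%g.

Lemma posn_mkpos f a : pos_fun f -> posn (mkpos f) a = f a.
Proof.
case=> f_lt f_out f_inj; case: (ltnP a n) => an; last by rewrite posn_out ?f_out.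
rewrite -[a in LHS]/(val (Ordinal an)) posnE invgK.
set g := [ffun i : 'I_n => insubd i (f i)].
have gE (i : 'I_n) : g i = f i :> nat.
  by rewrite ffunE val_insubd f_lt.
have g_inj : injectiveb g.
  by apply/injectiveP => i j /(congr1 val) /=; rewrite !gE => /f_inj/val_inj.
by rewrite unlock /= -[a in RHS]/(val (Ordinal an)) -gE /insubd insubT.
Qed.

Lemma right_weakP v w :
  reflect (forall a b, a < b -> posn v b < posn v a -> posn w b < posn w a)
          (right_weak_le v w).
Proof.
apply: (iffP idP) => [/forallP H a b ab ba|H]; last first.
  apply/forallP => i; apply/forallP => j; apply/implyP => /andP[ij].
  by rewrite /before -!posnE; apply: H.
case: (ltnP b n) => bn; last first.
  have := posn_lt v a; have := @posn_out v a; rewrite (posn_out v bn) in ba; lia.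
have an := ltn_trans ab bn.
have /forallP/(_ (Ordinal bn))/implyP := H (Ordinal an).
by rewrite /before /= -!posnE /= ab ba; apply.
Qed.

(** Inversions as pairs of values: right weak order is inclusion of these sets. *)
Definition vinv w : {set 'I_n * 'I_n} :=
  [set p : 'I_n * 'I_n | (p.1 < p.2) && (posn w p.2 < posn w p.1)].

Lemma card_vinv w : #|inversions w| = #|vinv w|.
Proof.
have inj : injective (fun p : 'I_n * 'I_n => (w p.2, w p.1)).
  by move=> [a b] [c e] [/perm_inj -> /perm_inj ->].
rewrite -(card_imset _ inj); apply: eq_card => -[a b]; rewrite inE /=.
apply/imsetP/andP => [[[c e] /[!inE] /= /andP[ce ec] [-> ->]]|[ab ba]].
  by rewrite !posnE !permK.
exists ((w^-1)%g b, (w^-1)%g a); rewrite ?inE /= ?permKV //.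
by rewrite -!posnE ba.
Qed.

(** Applying [t] to an inversion when this keeps the pair increasing, and leaving it alone
    otherwise, injects the old inversions into the new ones and misses [(i, j)]. *)
Lemma card_inversions_tperm v (i j : 'I_n) : i < j -> v i < v j ->
  #|inversions v| < #|inversions (tperm i j * v)%g|.
Proof.
move=> ij vij; set t := tperm i j.
have wt k : (t * v)%g (t k) = v k by rewrite permM tpermK.
pose phi (p : 'I_n * 'I_n) : 'I_n * 'I_n := if t p.1 < t p.2 then (t p.1, t p.2) else p.
have phi_inj : {in inversions v &, injective phi}.
  move=> [a b] [c e]; rewrite !inE /= /phi => /andP[ab _] /andP[ce _] /=.
  case: ifP => h1; case: ifP => h2 //.
  - by case=> /perm_inj -> /perm_inj ->.
  - by case=> e1 e2; move: h2; rewrite -e1 -e2 !tpermK ab.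
  by case=> e1 e2; move: h1; rewrite e1 e2 !tpermK ce.
rewrite -(card_in_imset phi_inj); apply: proper_card; apply/properP; split.
  apply/subsetP => q /imsetP[[a b]]; rewrite !inE /= => /andP[ab vba] ->.
  rewrite /phi /=; case: ifP => h /=; first by rewrite !wt h.
  rewrite ab /= !permM.
  move: h; rewrite /t; case: (tpermP i j a) => [e1|e1|/eqP n1 /eqP n2]; subst;
    case: (tpermP i j b) => [e2|e2|/eqP m1 /eqP m2]; subst; lia.
exists (i, j); first by rewrite inE /= ij !permM tpermL tpermR.
apply/imsetP => -[[a b]]; rewrite inE /= => /andP[ab vba]; rewrite /phi /=.
case: ifP => h [ea eb]; last by subst; lia.
by move: ab; rewrite -[a](tpermK i j) -[b](tpermK i j) -/t -ea -eb /t tpermL tpermR ltnNge ltnW.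
Qed.

(** The counting function of the tableau criterion. It is monotone along Bruhat order, and
    information on positions is drawn from [mid_bruhat] through it. *)
Definition cnt w p c : nat := \sum_(i < n) ((c <= i) && (posn w i < p)).

Lemma posn_tperm (i j : 'I_n) v (a : 'I_n) :
  posn (tperm i j * v)%g a = tperm i j ((v^-1)%g a).
Proof. by rewrite posnE invMg permM tpermV. Qed.

Lemma cnt_step v w p c : bruhat_step v w -> cnt v p c <= cnt w p c.
Proof.
case/andP=> /existsP[i /existsP[j /eqP ->]].
wlog ij : i j / i < j.
  move=> H; case: (ltngtP i j) => [|h|/val_inj ->]; first exact: H.
    by rewrite tpermC; apply: H.
  by rewrite tperm1 mul1g ltnn.
case: (ltngtP (v i) (v j)) => [vij _|vji|/val_inj/perm_inj e]; last by rewrite e ltnn in ij.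
  have nij : v i != v j by apply: contraTneq vij => ->; rewrite ltnn.
  rewrite /cnt (bigD1 (v i)) // (bigD1 (v j)) //= 1?eq_sym //.
  rewrite [leqRHS](bigD1 (v i)) // [X in _ <= _ + X](bigD1 (v j)) //= 1?eq_sym //.
  rewrite !posn_tperm !posnE !permK tpermL tpermR !addnA; apply: leq_add; last first.
    apply: leq_sum => k /andP[ki kj]; rewrite posn_tperm posnE tpermD //.
      by apply: contraNneq ki => ->; rewrite permKV.
    by apply: contraNneq kj => ->; rewrite permKV.
  by case: (leqP c (v i)); case: (leqP c (v j)); case: (ltnP i p); case: (ltnP j p) => //=; lia.
have := @card_inversions_tperm (tperm i j * v)%g i j ij.
rewrite !permM tpermL tpermR => /(_ vji).
by rewrite mulgA tperm2 mul1g => /ltn_trans h /h; rewrite ltnn.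
Qed.

Lemma bruhat_cnt v w p c : bruhat_le v w -> cnt v p c <= cnt w p c.
Proof.
case/connectP => s; elim: s v => [|u s IH] v /=; first by move=> _ ->.
by case/andP => /(cnt_step p c) h /IH{}IH /IH; apply: leq_trans.
Qed.

Lemma bruhat_card v w : bruhat_le v w -> v != w -> #|inversions v| < #|inversions w|.
Proof.
case/connectP => s; elim: s v => [|u s IH] v /=; first by move=> _ ->; rewrite eqxx.
case/andP => /andP[_ h] sp E _; case: (eqVneq u w) => [<- //|uw].
exact: ltn_trans h (IH _ sp E uw).
Qed.

Lemma cnt_gt0P w p c :
  reflect (exists2 a, c <= a < n & posn w a < p) (0 < cnt w p c).
Proof.
rewrite lt0n sum_nat_eq0; apply: (iffP idP).
  case/forallPn => i; rewrite /= eqb0 negbK => /andP[ci ip].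
  by exists (i : nat); rewrite ?ci ?ltn_ord.
case=> a /andP[ca an] ap; apply/forallPn; exists (Ordinal an) => /=.
by rewrite ca ap.
Qed.

Lemma sum_lt_ord p : p <= n -> \sum_(i < n) (i < p) = p.
Proof.
move=> pn; transitivity (\sum_(i < n | i < p) 1).
  by rewrite [RHS]big_mkcond; apply: eq_bigr => i _; case: ifP.
by rewrite -(big_ord_widen n (fun _ => 1) pn) sum1_card card_ord.
Qed.

Lemma sum_posn_lt w p : p <= n -> \sum_(i < n) (posn w i < p) = p.
Proof.
move=> pn; rewrite -[RHS](sum_lt_ord pn) [RHS](reindex_inj (@perm_inj _ w^-1%g)) /=.
by apply: eq_bigr => i _; rewrite posnE.
Qed.

Lemma cnt_compl w p c : p <= n -> c <= n ->
  cnt w p c + c = \sum_(i < n) ((i < c) && (p <= posn w i)) + p.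
Proof.
move=> pn cn.
rewrite /cnt -[X in _ + X = _](sum_lt_ord cn) -[X in _ = _ + X](sum_posn_lt w pn) -!big_split /=.
apply: eq_bigr => i _.
by case: (leqP c i); case: (ltnP (posn w i) p).
Qed.

Lemma bruhat_left v w p c : bruhat_le v w ->
  (exists2 a, c <= a < n & posn v a < p) -> exists2 a, c <= a < n & posn w a < p.
Proof.
move=> vw /cnt_gt0P h; apply/cnt_gt0P; apply: leq_trans h _; exact: bruhat_cnt.
Qed.

Lemma bruhat_right v w p c : p <= n -> c <= n -> bruhat_le v w ->
  (exists2 a, a < c & p <= posn v a) -> exists2 a, a < c & p <= posn w a.
Proof.
move=> pn cn vw [a ac pa].
have gt0 : 0 < \sum_(i < n) ((i < c) && (p <= posn v i)).
  have an := leq_trans ac cn; rewrite (bigD1 (Ordinal an)) //= ac pa; lia.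
have := bruhat_cnt p c vw.
rewrite -(leq_add2r c) !cnt_compl // leq_add2r => /(leq_trans gt0).
rewrite lt0n sum_nat_eq0 => /forallPn[i]; rewrite /= eqb0 negbK => /andP[ic pi].
by exists (i : nat).
Qed.
End Positions.

(** * Cycles, block exchanges and reversals *)

Section Elements.
Variable n : nat.
Implicit Types (v w : 'S_n) (f : nat -> nat).

Lemma pos_descent w : w != 1%g -> exists2 a, a.+1 < n & posn w a.+1 < posn w a.
Proof.
move=> w1; case: (boolP [exists a : 'I_n, (a.+1 < n) && (posn w a.+1 < posn w a)]).
  by case/existsP => a /andP[an lt]; exists (a : nat).
rewrite negb_exists => /forallP H; case/eqP: w1; apply: posn_ext => a an; rewrite posn1.
have step b : b.+1 < n -> posn w b < posn w b.+1.
  move=> bn; have := H (Ordinal (ltnW bn)); rewrite /= bn /= -leqNgt leq_eqVlt.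
  by case/orP => // /eqP/posn_inj; lia.
have lo b : b < n -> b <= posn w b.
  by elim: b => // b IH bn; have := step b bn; have := IH (ltnW bn); lia.
have hi b : b < n -> posn w (n.-1 - b) <= n.-1 - b.
  elim: b => [|b IH] bn; first by rewrite subn0; have := posn_lt w n.-1; lia.
  have := step (n.-1 - b.+1); have -> : (n.-1 - b.+1).+1 = n.-1 - b by lia.
  have := IH (ltnW bn); lia.
have := lo a an; have := hi (n.-1 - a); rewrite subKn; lia.
Qed.

(** A descent of [w^-1] sits at adjacent positions of [w], and undoing it removes only that
    inversion. This is the descending step that [rank_modular] asks for. *)
Lemma weak_cover w : w != 1%g ->
  exists v, [/\ right_weak_le v w, v != w & #|inversions w| <= #|inversions v|.+1].
Proof.
move=> w1; have [p pn lt] : exists2 p, p.+1 < n & posn w^-1 p.+1 < posn w^-1 p.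
  by apply: pos_descent; rewrite invg_eq1.
have pn' := ltnW pn; pose i := Ordinal pn'; pose j := Ordinal pn.
rewrite -[p.+1]/(val j) -[p]/(val i) !posnE invgK in lt.
exists (tperm i j * w)%g.
have E (a : 'I_n) : posn (tperm i j * w)%g a = tperm i j (w^-1%g a) by rewrite posn_tperm.
have F k : val (tperm i j k) = if val k == p then p.+1 else if val k == p.+1 then p else val k.
  case: tpermP => [->|->|/eqP/negPf h1 /eqP/negPf h2] /=; rewrite ?eqxx //.
    by case: eqP => //; lia.
  by rewrite -[p]/(val i) -[p.+1]/(val j) !val_eqE h1 h2.
split.
- apply/forallP => a; apply/forallP => b; apply/implyP; rewrite /before -!posnE => /andP[ab].
  have ne : ~ (val (w^-1%g a) = p /\ val (w^-1%g b) = p.+1).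
    case=> /(@ord_inj _ _ i) ea /(@ord_inj _ _ j) eb.
    by move: ab lt; rewrite -ea -eb !permKV; lia.
  have ne2 : val (w^-1%g a) <> val (w^-1%g b).
    by move/val_inj/perm_inj => e; rewrite e ltnn in ab.
  move: ne ne2; rewrite !E !F !posnE /= => ne ne2.
  by case: eqP => h1; case: eqP => h2; try case: eqP => h3; try case: eqP => h4; lia.
- apply/eqP => /(canRL (mulgK _)); rewrite mulgV => /(congr1 (fun s : 'S_n => s i)).
  by rewrite tpermL perm1 => /(congr1 val) /=; lia.
rewrite !card_vinv; apply: leq_trans (_ : #|(w j, w i) |: vinv (tperm i j * w)%g| <= _); last first.
  by rewrite cardsU1; case: (_ \notin _).
apply: subset_leq_card; apply/subsetP => -[a b]; rewrite !inE /= !E !F !posnE => /andP[ab].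
case: (eqVneq (a, b) (w j, w i)) => //= ne lt'; rewrite ab /=.
have ne' : ~ (val (w^-1%g a) = p.+1 /\ val (w^-1%g b) = p).
  case=> /(@ord_inj _ _ j) ea /(@ord_inj _ _ i) eb; case/eqP: ne.
  by rewrite -ea -eb !permKV.
move: ne' lt' => /= ne' lt'.
by case: eqP => h1; case: eqP => h2; try case: eqP => h3; try case: eqP => h4; lia.
Qed.

(* The first five functions give the position of the value [a] in the permutations defined next:
   in the word of [cycL i k] the value [k] has moved left to position [i], and in that of
   [cycR i k] the value [i] has moved right to position [k]. [gen d] exchanges [d - 1] and [d]. *)
Definition cL (i k a : nat) := if a == k then i else if i <= a < k then a.+1 else a.
Definition cR (i k a : nat) := if a == i then k else if i < a <= k then a.-1 else a.
Definition sw (i k a : nat) := if a == i then k else if a == k then i else a.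
Definition blk (x r y a : nat) :=
  if x <= a < r then a + (y - r) else if r <= a < y then a - (r - x) else a.
Definition rv (lo hi a : nat) := if lo <= a < hi then lo + hi - a.+1 else a.

Definition cycL i k : 'S_n := mkpos n (cL i k).
Definition cycR i k : 'S_n := mkpos n (cR i k).
Definition swap i k : 'S_n := mkpos n (sw i k).
Definition block_swap x r y : 'S_n := mkpos n (blk x r y).
Definition interval_rev lo hi : 'S_n := mkpos n (rv lo hi).
Definition gen d : 'S_n := cycL d.-1 d.

Ltac pos_tac def := apply: posn_mkpos; split=> [? ?|? ?|? ?]; rewrite /def;
  repeat match goal with |- context [if ?c then _ else _] => case: (boolP c) => ? end; lia.

Lemma posn_cycL i k a : i <= k -> k < n -> posn (cycL i k) a = cL i k a.
Proof. move=> ik kn. pos_tac cL. Qed.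

Lemma posn_cycR i k a : i <= k -> k < n -> posn (cycR i k) a = cR i k a.
Proof. move=> ik kn. pos_tac cR. Qed.

Lemma posn_swap i k a : i <= k -> k < n -> posn (swap i k) a = sw i k a.
Proof. move=> ik kn. pos_tac sw. Qed.

Lemma posn_block_swap x r y a : x <= r <= y -> y <= n ->
  posn (block_swap x r y) a = blk x r y a.
Proof. move=> xry yn. pos_tac blk. Qed.

Lemma posn_interval_rev lo hi a : hi <= n -> posn (interval_rev lo hi) a = rv lo hi a.
Proof. move=> hn. pos_tac rv. Qed.

(** The inversion sets of cycles, block exchanges and shuffles are made of such rectangles of value
    pairs, so lengths become areas. *)
Definition rect x r x' y : {set 'I_n * 'I_n} :=
  [set p : 'I_n * 'I_n | (x <= p.1 < r) && (x' <= p.2 < y)].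

Lemma card_rect x r x' y : r <= n -> y <= n -> #|rect x r x' y| = (r - x) * (y - x').
Proof.
have card_itv lo hi : hi <= n -> #|[set a : 'I_n | lo <= a < hi]| = hi - lo.
  move=> hn; rewrite -sum1dep_card -(big_mkord (fun a => lo <= a < hi) (fun _ => 1)).
  rewrite -big_filter sum1_size.
  rewrite -[RHS](size_iota lo); apply: perm_size; apply: uniq_perm.
  - by rewrite filter_uniq ?iota_uniq.
  - exact: iota_uniq.
  by move=> a; rewrite mem_filter mem_index_iota mem_iota; lia.
move=> rn yn; rewrite -(card_itv x r rn) -(card_itv x' y yn) -cardsX.
by apply: eq_card => -[a b]; rewrite !inE.
Qed.
End Elements.

Ltac split_ifs := repeat match goal with
  | |- context [if ?c then _ else _] => case: (boolP c) => ? end.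

Notation ell w := #|inversions w|.

(** * Lengths and supports of the explicit permutations *)

Section Lengths.
Variable n : nat.
Implicit Types (v w : 'S_n).

Lemma right_weak1 w : right_weak_le 1%g w.
Proof. by apply/right_weakP => a b ab; rewrite !posn1; lia. Qed.

Lemma right_weak_gen w d : 0 < d -> posn w d < posn w d.-1 -> right_weak_le (gen n d) w.
Proof.
move=> d0 lt; have dn : d < n.
  have := posn_lt w d; have := posn_lt w d.-1.
  by have := @posn_out _ w d; have := @posn_out _ w d.-1; lia.
apply/right_weakP => a b ab; rewrite !posn_cycL ?leq_pred // /cL => h.
have [-> ->] : a = d.-1 /\ b = d; last by [].
by move: h; split_ifs; lia.
Qed.

Lemma ell1 : ell (1%g : 'S_n) = 0.
Proof.
apply/eqP; rewrite cards_eq0; apply/eqP/setP => -[a b]; rewrite !inE /= !perm1; lia.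
Qed.

Lemma ell_cycL i k : i <= k < n -> ell (cycL n i k) = k - i.
Proof.
case/andP=> ik kn; rewrite card_vinv; transitivity #|rect n i k k k.+1|.
  apply: eq_card => -[a b]; rewrite !inE /= !posn_cycL // /cL; split_ifs; lia.
rewrite card_rect //; lia.
Qed.

Lemma ell_cycR i k : i <= k < n -> ell (cycR n i k) = k - i.
Proof.
case/andP=> ik kn; rewrite card_vinv; transitivity #|rect n i i.+1 i.+1 k.+1|.
  apply: eq_card => -[a b]; rewrite !inE /= !posn_cycR // /cR; split_ifs; lia.
rewrite card_rect //; lia.
Qed.

Lemma ell_gen d : 0 < d < n -> ell (gen n d) = 1.
Proof. by move=> dn; rewrite ell_cycL; lia. Qed.

(** The value inversions of the swap are those of the two cycles together, which share only the pair
    [(i, k)]. *)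
Lemma ell_swap i k : i < k < n ->
  ell (swap n i k) + 1 = ell (cycR n i k) + ell (cycL n i k).
Proof.
case/andP=> ik kn; have ik' := ltnW ik; rewrite !card_vinv -cardsUI; congr (_ + _).
  apply: eq_card => -[a b]; rewrite !inE /= !posn_cycL // !posn_cycR // !posn_swap //.
  rewrite /cL /cR /sw; split_ifs; lia.
transitivity #|rect n i i.+1 k k.+1|; first by rewrite card_rect; lia.
apply: eq_card => -[a b]; rewrite !inE /= !posn_cycL // !posn_cycR // /cL /cR.
split_ifs; lia.
Qed.

Lemma ell_block_swap x r y : x <= r <= y -> y <= n ->
  ell (block_swap n x r y) = (r - x) * (y - r).
Proof.
move=> xry yn; rewrite card_vinv; transitivity #|rect n x r r y|.
  apply: eq_card => -[a b]; rewrite !inE /= !posn_block_swap // /blk; split_ifs; lia.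
by rewrite card_rect //; lia.
Qed.

Lemma ell_interval_rev lo r hi : lo <= r <= hi -> hi <= n ->
  ell (interval_rev n lo hi) = ell (interval_rev n lo r) + ell (interval_rev n r hi)
     + ell (block_swap n lo r hi).
Proof.
move=> lrh hn; have rn : r <= n by lia.
rewrite !card_vinv -cardsUI [X in _ + X + _](_ : _ = 0) ?addn0; last first.
  apply/eqP; rewrite cards_eq0; apply/eqP/setP => -[a b]; rewrite !inE /=.
  rewrite !posn_interval_rev // /rv; split_ifs; lia.
rewrite -cardsUI [X in _ + X](_ : _ = 0) ?addn0; last first.
  apply/eqP; rewrite cards_eq0; apply/eqP/setP => -[a b]; rewrite !inE /=.
  rewrite !posn_interval_rev // !posn_block_swap // /rv /blk; split_ifs; lia.
apply: eq_card => -[a b]; rewrite !inE /=.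
rewrite !posn_interval_rev // !posn_block_swap // /rv /blk; split_ifs; lia.
Qed.

Definition supported lo hi w := forall a, ~~ (lo <= a < hi) -> posn w a = a.

Lemma supported_range lo hi w a : supported lo hi w -> lo <= a < hi -> lo <= posn w a < hi.
Proof.
move=> sw ha; apply: contraT => np; have := sw _ np => /posn_inj e.
by rewrite e ha in np.
Qed.

Lemma supported_weak lo hi w : hi <= n -> supported lo hi w ->
  right_weak_le w (interval_rev n lo hi).
Proof.
move=> hn sw; apply/right_weakP => a b ab ba; rewrite !posn_interval_rev // /rv.
have := sw a; have := sw b; have := @supported_range _ _ _ a sw.
have := @supported_range _ _ _ b sw; split_ifs; lia.
Qed.

Lemma supported_cycL lo hi i k : lo <= i <= k -> k < hi <= n -> supported lo hi (cycL n i k).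
Proof. by move=> h1 h2 a; rewrite posn_cycL ?/cL; split_ifs; lia. Qed.

Lemma supported_cycR lo hi i k : lo <= i <= k -> k < hi <= n -> supported lo hi (cycR n i k).
Proof. by move=> h1 h2 a; rewrite posn_cycR ?/cR; split_ifs; lia. Qed.

Lemma supported_block_swap lo hi x r y : lo <= x <= r -> r <= y <= hi -> hi <= n ->
  supported lo hi (block_swap n x r y).
Proof. by move=> h1 h2 h3 a; rewrite posn_block_swap ?/blk; split_ifs; lia. Qed.

Lemma supported_interval_rev lo hi lo' hi' : lo' <= lo -> hi <= hi' -> hi' <= n ->
  supported lo' hi' (interval_rev n lo hi).
Proof. by move=> h1 h2 h3 a; rewrite posn_interval_rev ?/rv; split_ifs; lia. Qed.

Lemma supported_gen_range lo hi d : 0 < d < n -> supported lo hi (gen n d) -> lo < d < hi.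
Proof.
move=> dn h; have := h d; have := h d.-1; rewrite !posn_cycL /cL; try lia.
by split_ifs; lia.
Qed.
End Lengths.

(** * Length as the rank function of a middle order *)

Section MiddleOrderLattice.
Variables (n : nat) (M : middle_order n).
Implicit Types (u v w : 'S_n).
Notation "x <<= y" := (mid_le M x y) (at level 70).
Notation meet := (mid_meet M).
Notation join := (mid_join M).

Lemma mid_lexx w : w <<= w. Proof. exact: mid_refl. Qed.

Lemma mid_le_trans v u w : u <<= v -> v <<= w -> u <<= w.
Proof. exact: mid_trans. Qed.

Lemma mid_le_anti v w : v <<= w -> w <<= v -> v = w.
Proof. by move=> h1 h2; apply: (@mid_anti _ M); rewrite h1. Qed.

Lemma mid_le1 w : 1%g <<= w.
Proof. exact/mid_weak/right_weak1. Qed.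

Lemma mid_join_l v w : v <<= join v w.
Proof. by have := mid_joinP M v w (join v w); rewrite mid_lexx => /esym/andP[]. Qed.

Lemma mid_join_r v w : w <<= join v w.
Proof. by have := mid_joinP M v w (join v w); rewrite mid_lexx => /esym/andP[]. Qed.

Lemma mid_meet_l v w : meet v w <<= v.
Proof. by have := mid_meetP M (meet v w) v w; rewrite mid_lexx => /esym/andP[]. Qed.

Lemma mid_meet_r v w : meet v w <<= w.
Proof. by have := mid_meetP M (meet v w) v w; rewrite mid_lexx => /esym/andP[]. Qed.

Lemma mid_join_le u v w : u <<= w -> v <<= w -> join u v <<= w.
Proof. by move=> h1 h2; rewrite mid_joinP h1. Qed.

Lemma mid_le_meet u v w : u <<= v -> u <<= w -> u <<= meet v w.
Proof. by move=> h1 h2; rewrite mid_meetP h1. Qed.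

Lemma mid_le_ell v w : v <<= w -> v != w -> ell v < ell w.
Proof. by move/mid_bruhat; apply: bruhat_card. Qed.

Lemma mid_le_ell_eq v w : v <<= w -> ell w <= ell v -> v = w.
Proof.
by move=> vw h; apply/eqP; apply: contraTT h => /(mid_le_ell vw); rewrite -ltnNge.
Qed.

Lemma mid_rank v w : ell (join v w) + ell (meet v w) = ell v + ell w.
Proof.
have := @rank_modular _ (ordered_perm M) (1%g : 'S_n) (fun w => ell w) v w.
apply.
- by move=> x y; rewrite Order.POrderTheory.lt_neqAle => /andP[xy h]; apply: mid_le_ell.
- exact: mid_le1.
- exact: ell1.
move=> x x1; have [y [yx ne le]] := weak_cover x1.
by exists y => //; rewrite Order.POrderTheory.lt_neqAle ne; apply: mid_weak.
Qed.

Lemma mid_meet_eq1 v w : meet v w = 1%g -> ell (join v w) = ell v + ell w.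
Proof. by move=> h; rewrite -mid_rank h ell1 addn0. Qed.

Lemma mid_gen w : w != 1%g -> exists2 d, 0 < d < n & gen n d <<= w.
Proof.
case/pos_descent => a an lt; exists a.+1; first by [].
exact/mid_weak/right_weak_gen.
Qed.

(** The reversal has every inversion a supported permutation can have, so weak order gives one
    direction. Conversely no value of the reversal crosses a cut [t] with [t <= lo] or [hi <= t],
    and Bruhat order passes this down to [w]. *)
Lemma mid_le_rev lo hi w : lo <= hi <= n ->
  (w <<= interval_rev n lo hi) <-> supported lo hi w.
Proof.
move=> /andP[lh hn]; split=> [le|]; last by move/(supported_weak hn)/mid_weak.
have bru := mid_bruhat le.
have stable t : t <= n -> (t <= lo) || (hi <= t) ->
    (forall a, t <= a -> t <= posn w a) /\ (forall a, a < t -> posn w a < t).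
  move=> tn ht; split=> a ta.
    case: (ltnP a n) => an; last by rewrite posn_out.
    rewrite leqNgt; apply/negP => lt.
    have [|b /andP[tb bn]] := bruhat_left (p := t) (c := t) bru.
      by exists a; rewrite ?ta.
    rewrite posn_interval_rev // /rv; split_ifs; lia.
  rewrite ltnNge; apply/negP => lt.
  have [|b bt] := bruhat_right (p := t) (c := t) tn tn bru; first by exists a.
  rewrite posn_interval_rev // /rv; split_ifs; lia.
move=> a na; case: (leqP n a) => an; first exact: posn_out.
have [|/(_ a) h1 _] := stable a (ltnW an); first by lia.
have [|_ /(_ a) h2] := stable a.+1 an; first by lia.
by lia.
Qed.
End MiddleOrderLattice.

(** * Joins with forced rank *)

Section CyclesAndSupports.
Variable n : nat.
Implicit Types (v w : 'S_n).

Lemma weak_cycL i k w : i <= k < n ->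
  (forall a, i <= a < k -> posn w k < posn w a) -> right_weak_le (cycL n i k) w.
Proof.
case/andP=> ik kn H; apply/right_weakP => a b ab; rewrite !posn_cycL // /cL => h.
have [e1 e2] : i <= a < k /\ b = k by move: h; split_ifs; lia.
by rewrite e2 H.
Qed.

Lemma weak_cycR i k w : i <= k < n ->
  (forall a, i < a <= k -> posn w a < posn w i) -> right_weak_le (cycR n i k) w.
Proof.
case/andP=> ik kn H; apply/right_weakP => a b ab; rewrite !posn_cycR // /cR => h.
have [e1 e2] : i < b <= k /\ a = i by move: h; split_ifs; lia.
by rewrite e2 H.
Qed.

Lemma supported_trivial lo w : supported lo lo.+1 w -> w = 1%g.
Proof.
move=> sw; apply: posn_ext => a _; rewrite posn1.
case: (boolP (lo <= a < lo.+1)) => h; last exact: sw.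
have := supported_range sw h; lia.
Qed.

Lemma supportedI lo hi lo' hi' w : supported lo hi w -> supported lo' hi' w ->
  supported (maxn lo lo') (minn hi hi') w.
Proof.
move=> s1 s2 a na; case: (boolP (lo <= a < hi)) => h1; last exact: s1.
by apply: s2; lia.
Qed.

Lemma supportedW lo hi lo' hi' w : lo' <= lo -> hi <= hi' ->
  supported lo hi w -> supported lo' hi' w.
Proof. by move=> h1 h2 sw a na; apply: sw; lia. Qed.

Lemma card_posn_itv w lo hi : hi <= n -> #|[set a : 'I_n | lo <= posn w a < hi]| = hi - lo.
Proof.
move=> hn; case: (posnP n) => [n0|n_gt0].
  have -> : hi - lo = 0 by lia.
  by apply/eqP; rewrite cards_eq0; apply/eqP/setP => a; have := ltn_ord a; lia.
have := @card_rect n lo hi 0 1 hn n_gt0; rewrite muln1 => <-.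
have inj : injective (fun a : 'I_n => ((w^-1)%g a, Ordinal n_gt0)).
  by move=> a b [/perm_inj].
rewrite -(card_imset _ inj); apply: eq_card => -[p q].
apply/imsetP/idP => [[a /[!inE] h [-> ->]]|].
  by move: h; rewrite posnE /=; lia.
rewrite !inE /= => h; exists (w p); first by rewrite inE posnE permK; lia.
by rewrite permK; congr pair; apply/val_inj => /=; lia.
Qed.

(** Two disjoint families of inversions: [b] stands first, hence before the [rho - i] values in [i,
    rho), and [hi - 1] stands before the values at positions [q + 1] to [hi - 1]. *)
Lemma ell_ge_two w i hi rho q b : supported i hi w -> hi <= n ->
    i <= rho <= b -> b.+1 < hi -> posn w b = i -> posn w hi.-1 <= q < hi ->
  rho - i + (hi.-1 - q) <= ell w.
Proof.
move=> sw hn rb bh bi qh; rewrite card_vinv.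
pose A := rect n i rho b b.+1.
have hn' : hi.-1 < n by lia.
pose top := Ordinal hn'.
pose B := [set (a, top) | a in [set a : 'I_n | q.+1 <= posn w a < hi]].
have cA : #|A| = rho - i by rewrite card_rect; lia.
have cB : #|B| = hi.-1 - q.
  by rewrite card_imset ?card_posn_itv //; [lia|move=> a c []].
have dAB : A :&: B = set0.
  apply/setP => -[a c]; rewrite !inE /=; apply/negP => /andP[h /imsetP[e _ [_ e2]]].
  by move: h; rewrite e2 /=; lia.
rewrite -cA -cB -cardsUI dAB cards0 addn0; apply: subset_leq_card.
apply/subsetP => -[a c]; rewrite !inE /= => /orP[h|/imsetP[e /[!inE] he [-> ->]] /=].
  have -> : val c = b by rewrite /=; lia.
  have ra := @supported_range _ _ _ _ (val a) sw; have := @posn_inj _ w (val a) b.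
  by rewrite bi /= in ra *; lia.
have := sw (val e); have := @posn_inj _ w (val e) hi.-1; rewrite /=.
have := @supported_range _ _ _ _ (val e) sw; rewrite /= => h1 h2 h3.
have : val e <> hi.-1 by move=> E; move: he; rewrite /= in E; rewrite E; lia.
rewrite /=; lia.
Qed.
End CyclesAndSupports.

(** * Roots and the joins that extend them *)

Section Roots.
Variables (n : nat) (M : middle_order n).
Implicit Types (u v w : 'S_n).
Notation "x <<= y" := (mid_le M x y) (at level 70).
Notation meet := (mid_meet M).
Notation join := (mid_join M).

Lemma mid_supported lo hi v w : lo <= hi <= n -> v <<= w -> supported lo hi w -> supported lo hi v.
Proof. by move=> h vw /(mid_le_rev M _ h)/(mid_le_trans vw)/mid_le_rev; apply. Qed.

Lemma mid_join_supported lo hi v w : lo <= hi <= n ->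
  supported lo hi v -> supported lo hi w -> supported lo hi (join v w).
Proof.
move=> h /(mid_le_rev M _ h) h1 /(mid_le_rev M _ h) h2.
by apply/(mid_le_rev M _ h)/mid_join_le.
Qed.

(** The meet inherits both supports, which share at most the value [m]. *)
Lemma mid_meet_trivial lo m hi v w : lo <= m <= hi -> m < n -> hi <= n ->
  supported lo m.+1 v -> supported m hi w -> meet v w = 1%g.
Proof.
move=> h1 h2 h3 sv sw; apply: (@supported_trivial _ m).
have := supportedI (mid_supported (lo := lo) (hi := m.+1) _ (mid_meet_l M v w) sv)
                   (mid_supported (lo := m) (hi := hi) _ (mid_meet_r M v w) sw).
move=> H; apply: (@supportedW _ (maxn lo m) (minn m.+1 hi)); try lia.
by apply: H; lia.
Qed.

Lemma mid_gen_range lo hi d w : lo <= hi <= n -> 0 < d < n ->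
  gen n d <<= w -> supported lo hi w -> lo < d < hi.
Proof.
by move=> h dn dw sw; apply: supported_gen_range dn _; apply: mid_supported dw sw.
Qed.

Lemma mid_cover_join v s w : v <<= w -> s <<= w -> ~ s <<= v ->
  ell w <= (ell v).+1 -> w = join v s.
Proof.
move=> vw sw nsv le; apply/esym/(mid_le_ell_eq (mid_join_le vw sw)).
apply: leq_trans le _; apply: (mid_le_ell (M := M)); first exact: mid_join_l.
by apply/eqP => e; apply: nsv; rewrite e; exact: mid_join_r.
Qed.

Lemma mid_cycL_pos i k hi w : i <= k < n -> k < hi -> supported i hi w ->
  cycL n i k <<= w -> exists2 b, k <= b < hi & posn w b = i.
Proof.
move=> /andP[ik kn] kh sw /mid_bruhat bru.
have [|b kb lt] := bruhat_left (p := i.+1) (c := k) bru.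
  by exists k; rewrite ?leqnn ?posn_cycL // /cL eqxx.
have := @supported_range _ _ _ _ b sw; have := sw b => h1 h2.
exists b; lia.
Qed.

Lemma mid_cycR_pos i k w : i <= k < n -> supported i k.+1 w ->
  cycR n i k <<= w -> posn w i = k.
Proof.
move=> /andP[ik kn] sw /mid_bruhat bru.
have [|||b bi le] := bruhat_right (p := k) (c := i.+1) _ _ bru; try lia.
  by exists i; rewrite ?posn_cycR // /cR eqxx.
have := @supported_range _ _ _ _ b sw; have := sw b => h1 h2.
have bE : b = i by lia.
by subst b; lia.
Qed.

(** Bruhat order forces the join to put [i] at position [k] and [k] at position [i], which already
    implies every inversion of the swap. *)
Lemma mid_join_cyc i k : i < k < n -> join (cycR n i k) (cycL n i k) = swap n i k.
Proof.
case/andP=> ik kn; have ik' := ltnW ik; apply: (@mid_le_anti _ M).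
  apply: mid_join_le; apply: mid_weak.
    by apply: weak_cycR => [|a ai]; rewrite ?ik' // !posn_swap // /sw; split_ifs; lia.
  by apply: weak_cycL => [|a ai]; rewrite ?ik' // !posn_swap // /sw; split_ifs; lia.
set j := join _ _.
have sj : supported i k.+1 j.
  apply: mid_join_supported; first by lia.
    by apply: supported_cycR; lia.
  by apply: supported_cycL; lia.
have pi : posn j i = k by apply: mid_cycR_pos (mid_join_l _ _ _); rewrite ?ik'.
have [||b bk pb] := mid_cycL_pos _ _ sj (mid_join_r M _ _); [by rewrite ik'|by []|].
have {bk}bk : b = k by lia.
subst b; apply/mid_weak/right_weakP => a c ac; rewrite !posn_swap // /sw => h.
have := @supported_range _ _ _ _ a sj; have := @supported_range _ _ _ _ c sj.
have := sj a; have := sj c.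
have := @posn_inj _ j a i; have := @posn_inj _ j c i.
have := @posn_inj _ j a k; have := @posn_inj _ j c k.
move: h; case: (eqVneq a i) => [->|?]; case: (eqVneq c k) => [->|?]; split_ifs; lia.
Qed.

(** The cycles share one inversion, so modularity leaves rank one for the meet. It is an atom, the
    source of the uniqueness of roots. *)
Lemma mid_meet_cyc i k : i < k < n -> ell (meet (cycR n i k) (cycL n i k)) = 1.
Proof.
move=> ikn; have := mid_rank M (cycR n i k) (cycL n i k).
by rewrite mid_join_cyc // -ell_swap //; lia.
Qed.

Lemma gen_inj p q : 0 < p < n -> 0 < q < n -> gen n p = gen n q -> p = q.
Proof.
move=> pn qn /(congr1 (fun w => posn w p)); rewrite !posn_cycL; try lia.
by rewrite /cL; split_ifs; lia.
Qed.

Lemma common_gen_uniq i k p q : i < k < n -> 0 < p < n -> 0 < q < n ->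
    gen n p <<= cycR n i k -> gen n p <<= cycL n i k ->
    gen n q <<= cycR n i k -> gen n q <<= cycL n i k -> p = q.
Proof.
move=> ikn pn qn pR pL qR qL; apply: gen_inj => //.
have E d : 0 < d < n -> gen n d <<= cycR n i k -> gen n d <<= cycL n i k ->
    gen n d = meet (cycR n i k) (cycL n i k).
  move=> dn dR dL; apply: (mid_le_ell_eq (M := M)); first exact: mid_le_meet.
  by rewrite mid_meet_cyc // ell_gen.
by rewrite (E p) // (E q).
Qed.

Lemma common_gen i k : i < k < n ->
  exists d, [/\ i < d <= k, gen n d <<= cycR n i k & gen n d <<= cycL n i k].
Proof.
move=> ikn; have [|d dn dm] := @mid_gen _ M (meet (cycR n i k) (cycL n i k)).
  by apply: contra_eqN (mid_meet_cyc ikn) => /eqP ->; rewrite ell1.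
have dR := mid_le_trans dm (mid_meet_l M _ _); have dL := mid_le_trans dm (mid_meet_r M _ _).
exists d; split=> //.
have := @mid_gen_range i k.+1 d _ _ dn dL; rewrite ltnS; apply; first by lia.
by apply: supported_cycL; lia.
Qed.

Lemma cycR_weak i k k' : i <= k <= k' -> k' < n -> cycR n i k <<= cycR n i k'.
Proof.
move=> h1 h2; apply/mid_weak/weak_cycR; first by lia.
by move=> a ai; rewrite !posn_cycR /cR; split_ifs; lia.
Qed.

Lemma cycL_weak i i' k : i <= i' <= k -> k < n -> cycL n i' k <<= cycL n i k.
Proof.
move=> h1 h2; apply/mid_weak/weak_cycL; first by lia.
by move=> a ai; rewrite !posn_cycL /cL; split_ifs; lia.
Qed.

Lemma gen_cycL i k : i < k < n -> gen n k <<= cycL n i k.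
Proof. by move=> h; apply: cycL_weak; lia. Qed.

Lemma gen_cycR i k : i < k < n -> gen n i.+1 <<= cycR n i k.
Proof.
move=> h; apply/mid_weak/right_weak_gen => //; rewrite !posn_cycR /cR; split_ifs; lia.
Qed.

(** If [gen n d] first appeared under [cycR n i k.+1], that cycle would be the join of [cycR n i k]
    and [gen n d]; both of these fix [k + 1], and the cycle does not. *)
Lemma gen_cycR_restrict i d k : i < d <= k -> k < n ->
  gen n d <<= cycR n i k -> gen n d <<= cycR n i d.
Proof.
move=> /andP[id]; elim: k => [|k IH]; first by lia.
rewrite leq_eqVlt => /orP[/eqP <- //|dk] kn dR.
case: (boolP (gen n d <<= cycR n i k)) => [|/negP nd]; first by apply: IH; lia.
have E : cycR n i k.+1 = join (cycR n i k) (gen n d).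
  by apply: mid_cover_join; rewrite ?cycR_weak // ?ell_cycR; lia.
have : supported i k.+1 (cycR n i k.+1).
  rewrite E; apply: mid_join_supported; first by lia.
    by apply: supported_cycR; lia.
  by apply: supported_cycL; lia.
by move/(_ k.+1); rewrite posn_cycR /cR; [split_ifs; lia|lia|lia].
Qed.

Definition mid_root lo hi r : Prop :=
  [/\ lo < r < hi, forall i, lo <= i < r -> gen n r <<= cycR n i r
    & forall k, r <= k < hi -> gen n r <<= cycL n r.-1 k].

(* The join of [cycL i rho] and [cycL rho (hi - 1)] puts some value [b >= rho] at position [i] and
   [hi - 1] before position [rho]; its rank only leaves room for this if [b = hi - 1]. *)
Lemma cycL_root_le lo hi rho i : hi <= n -> mid_root lo hi rho -> lo <= i < rho ->
  cycL n i rho <<= cycL n i hi.-1.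
Proof.
move=> hn [rh _ K2] ih.
case: (eqVneq rho hi.-1) => [<-|ne]; first exact: mid_lexx.
set G := cycL n rho hi.-1; set V := cycL n i rho; pose kap := join V G.
have sV : supported i rho.+1 V by apply: supported_cycL; lia.
have sG : supported rho hi G by apply: supported_cycL; lia.
have ek : ell kap = hi.-1 - i.
  rewrite mid_meet_eq1; first by rewrite !ell_cycL; lia.
  by apply: (mid_meet_trivial _ _ _ sV sG); lia.
have sk : supported i hi kap.
  by apply: mid_join_supported; [lia|apply: supportedW sV; lia|apply: supportedW sG; lia].
have [||b bh pb] := mid_cycL_pos _ _ sk (mid_join_l M V G); try lia.
have E : cycL n rho.-1 hi.-1 = join G (gen n rho).
  apply: mid_cover_join.
  - by apply: cycL_weak; lia.
  - by apply: K2; lia.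
  - by move=> h; have := @mid_gen_range rho hi rho _ _ _ h sG; lia.
  by rewrite !ell_cycL; lia.
have le1 : cycL n rho.-1 hi.-1 <<= kap.
  rewrite E; apply: mid_join_le; first exact: mid_join_r.
  by apply: mid_le_trans (mid_join_l M _ _); apply: gen_cycL; lia.
have ptop : posn kap hi.-1 <= rho.-1.
  have [|c ch pc] := bruhat_left (p := rho) (c := hi.-1) (mid_bruhat le1).
    by exists hi.-1; rewrite ?posn_cycL /cL ?eqxx; lia.
  by have cE : c = hi.-1; [have := sk c; lia|rewrite -cE; lia].
case: (eqVneq b hi.-1) => [bE|nb].
  have cE : cycL n i hi.-1 = kap.
    apply: (mid_le_ell_eq (M := M)); last by rewrite ek ell_cycL; lia.
    apply/mid_weak/weak_cycL; first by lia.
    move=> a ai; rewrite -bE pb; have := @supported_range _ _ _ _ a sk.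
    by have := @posn_inj _ kap a b; rewrite pb; lia.
  by rewrite cE; exact: mid_join_l.
(* The forced inversions number [(rho - i) + (hi - rho)], one more than [ell kap]. *)
have := @ell_ge_two _ kap i hi rho rho.-1 b sk; rewrite ek; lia.
Qed.

(** The rank argument of [cycL_root_le] for the join [kap] of [s] and [V]. The root [rho] puts
    [cycL n lo.+1 rho] below [V], and adjoining [s] gives [cycL n lo rho]; so some [b >= rho] stands
    at [lo], and [hi - 1] stands no later than [lo + 1]. The length only allows [b = hi - 1]. *)
Lemma root_left_extend lo hi rho : hi <= n -> mid_root lo hi.-1 lo.+1 ->
  mid_root lo.+1 hi rho -> rho < hi.-1 -> gen n lo.+1 <<= cycL n lo hi.-1.
Proof.
move=> hn [lh _ K2] R2 rh; have [rh2 _ _] := R2.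
set s := gen n lo.+1; set V := cycL n lo.+1 hi.-1; pose kap := join s V.
have ss : supported lo lo.+2 s by apply: supported_cycL; lia.
have sV : supported lo.+1 hi V by apply: supported_cycL; lia.
have ek : ell kap = hi.-1 - lo.
  rewrite mid_meet_eq1; first by rewrite !ell_cycL; lia.
  by apply: (mid_meet_trivial _ _ _ ss sV); lia.
have sk : supported lo hi kap.
  by apply: mid_join_supported; [lia|apply: supportedW ss; lia|apply: supportedW sV; lia].
have le0 : cycL n lo.+1 rho <<= kap.
  by apply: mid_le_trans (mid_join_r M _ _); apply: cycL_root_le R2 _; lia.
have E : cycL n lo rho = join (cycL n lo.+1 rho) s.
  apply: mid_cover_join.
  - by apply: cycL_weak; lia.
  - by apply: K2; lia.
  - have sl : supported lo.+1 rho.+1 (cycL n lo.+1 rho) by apply: supported_cycL; lia.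
    by move=> h; have := @mid_gen_range lo.+1 rho.+1 lo.+1 _ _ _ h sl; lia.
  by rewrite !ell_cycL; lia.
have le1 : cycL n lo rho <<= kap by rewrite E; apply: mid_join_le => //; exact: mid_join_l.
have [||b bh pb] := mid_cycL_pos _ _ sk le1; try lia.
have ptop : posn kap hi.-1 <= lo.+1.
  have [|c ch pc] := bruhat_left (p := lo.+2) (c := hi.-1) (mid_bruhat (mid_join_r M s V)).
    by exists hi.-1; rewrite /V ?posn_cycL /cL ?eqxx; lia.
  rewrite -/kap in pc; by have cE : c = hi.-1; [have := sk c; lia|rewrite -cE; lia].
case: (eqVneq b hi.-1) => [bE|nb].
  have cE : cycL n lo hi.-1 = kap.
    apply: (mid_le_ell_eq (M := M)); last by rewrite ek ell_cycL; lia.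
    apply/mid_weak/weak_cycL; first by lia.
    move=> a ai; rewrite -bE pb; have := @supported_range _ _ _ _ a sk.
    by have := @posn_inj _ kap a b; rewrite pb; lia.
  by rewrite cE; exact: mid_join_l.
have := @ell_ge_two _ kap lo hi rho lo.+1 b sk; rewrite ek; lia.
Qed.
End Roots.

(** * The mirror image of a middle order *)

Section Mirror.
Variable n : nat.
Implicit Types (v w : 'S_n).

(** Conjugation by the longest permutation. It preserves weak and Bruhat order, so it carries [M] to
    another middle order; it exchanges [cycL] and [cycR], turning left-hand statements into
    right-hand ones. *)
Definition mirror w : 'S_n :=
  (perm (@rev_ord_inj n) * w * perm (@rev_ord_inj n))%g.

Let rev2 : (perm (@rev_ord_inj n) * perm (@rev_ord_inj n) = 1)%g.
Proof. by apply/permP => i; rewrite permM perm1 !permE rev_ordK. Qed.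

Let revV : (perm (@rev_ord_inj n))^-1%g = perm (@rev_ord_inj n).
Proof. by apply/eqP; rewrite eq_invg_mul rev2. Qed.

Lemma mirrorK : involutive mirror.
Proof. by move=> w; rewrite /mirror !mulgA rev2 mul1g -mulgA rev2 mulg1. Qed.

Lemma posn_mirror w a :
  posn (mirror w) a = if a < n then n.-1 - posn w (n.-1 - a) else a.
Proof.
case: (ltnP a n) => an; last by rewrite posn_out.
rewrite -[a in LHS]/(val (Ordinal an)) posnE /mirror !invMg revV !permM !(permE (@rev_ord_inj n)).
have -> : n.-1 - a = rev_ord (Ordinal an) by rewrite /=; lia.
by rewrite posnE; move: (w^-1 _)%g => i /=; lia.
Qed.

Lemma card_inversions_mirror w : #|inversions (mirror w)| = #|inversions w|.
Proof.
have inj : injective (fun p : 'I_n * 'I_n => (rev_ord p.2, rev_ord p.1)).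
  move=> [a b] [c e] E; have := congr1 fst E; have := congr1 snd E.
  by move=> /= /rev_ord_inj -> /rev_ord_inj ->.
rewrite !card_vinv -[RHS](card_imset _ inj); apply: eq_card => -[a b].
rewrite inE /= !posn_mirror !ltn_ord.
have [an bn] := (ltn_ord a, ltn_ord b).
have := posn_lt w (n.-1 - a); have := posn_lt w (n.-1 - b) => h1 h2.
apply/idP/imsetP => [h|[[c e] /[!inE] /= h [-> ->]] /=].
  exists (rev_ord b, rev_ord a); last by rewrite /= !rev_ordK.
  rewrite inE /=.
  have -> : n - b.+1 = n.-1 - b by lia.
  have -> : n - a.+1 = n.-1 - a by lia.
  by lia.
have [cn en] := (ltn_ord c, ltn_ord e).
have -> : n.-1 - (n - e.+1) = e by lia.
have -> : n.-1 - (n - c.+1) = c by lia.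
have := posn_lt w c; have := posn_lt w e; lia.
Qed.

Lemma mirror_bruhat v w : bruhat_le v w -> bruhat_le (mirror v) (mirror w).
Proof.
case/connectP => s; elim: s v => [|u s IH] v /=; first by move=> _ ->; exact: connect0.
case/andP => /andP[/existsP[i /existsP[j /eqP uE]] lt] sp E.
apply: connect_trans (IH _ sp E); apply: connect1.
rewrite /bruhat_step !card_inversions_mirror lt andbT.
apply/existsP; exists (rev_ord i); apply/existsP; exists (rev_ord j).
apply/eqP; rewrite uE /mirror -[rev_ord i](permE (@rev_ord_inj n)).
rewrite -[rev_ord j](permE (@rev_ord_inj n)) -tpermJ /conjg revV.
by rewrite !mulgA -[(_ * perm _ * perm _)%g]mulgA rev2 mulg1.
Qed.

Lemma mirror_weak v w : right_weak_le v w -> right_weak_le (mirror v) (mirror w).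
Proof.
move/right_weakP => H; apply/right_weakP => a b ab; rewrite !posn_mirror.
case: (ltnP b n) => bn; case: (ltnP a n) => an; try lia.
  have := H (n.-1 - b) (n.-1 - a).
  have := posn_lt w (n.-1 - b); have := posn_lt w (n.-1 - a).
  have := posn_lt v (n.-1 - b); have := posn_lt v (n.-1 - a).
  lia.
Qed.

Variable M : middle_order n.

Definition mirror_le v w := mid_le M (mirror v) (mirror w).
Definition mirror_meet v w := mirror (mid_meet M (mirror v) (mirror w)).
Definition mirror_join v w := mirror (mid_join M (mirror v) (mirror w)).

Lemma mirror_refl : reflexive mirror_le.
Proof. by move=> w; apply: mid_refl. Qed.
Lemma mirror_anti : antisymmetric mirror_le.
Proof. by move=> v w h; apply: (can_inj mirrorK); apply: (@mid_anti _ M) h. Qed.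
Lemma mirror_trans : transitive mirror_le.
Proof. by move=> u v w; apply: mid_trans. Qed.
Lemma mirror_meetP u v w :
  mirror_le u (mirror_meet v w) = mirror_le u v && mirror_le u w.
Proof. by rewrite /mirror_le mirrorK mid_meetP. Qed.
Lemma mirror_joinP u v w :
  mirror_le (mirror_join u v) w = mirror_le u w && mirror_le v w.
Proof. by rewrite /mirror_le mirrorK mid_joinP. Qed.
Lemma mirror_meetUl : left_distributive mirror_meet mirror_join.
Proof. by move=> u v w; rewrite /mirror_meet /mirror_join !mirrorK mid_meetUl. Qed.
Lemma mirror_le_weak v w : right_weak_le v w -> mirror_le v w.
Proof. by move=> h; apply: mid_weak; apply: mirror_weak. Qed.
Lemma mirror_le_bruhat v w : mirror_le v w -> bruhat_le v w.
Proof. by move/mid_bruhat/mirror_bruhat; rewrite !mirrorK. Qed.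

Definition mirror_order : middle_order n :=
  MiddleOrder mirror_refl mirror_anti mirror_trans mirror_meetP mirror_joinP
    mirror_meetUl mirror_le_weak mirror_le_bruhat.

Lemma mirror_cycL i k : i <= k < n -> mirror (cycL n i k) = cycR n (n.-1 - k) (n.-1 - i).
Proof.
move=> ikn; apply: posn_ext => a an.
rewrite posn_mirror an posn_cycL ?posn_cycR /cL /cR; try lia.
by split_ifs; lia.
Qed.

Lemma mirror_cycR i k : i <= k < n -> mirror (cycR n i k) = cycL n (n.-1 - k) (n.-1 - i).
Proof.
move=> ikn; rewrite -[RHS]mirrorK mirror_cycL; last by lia.
by congr (mirror (cycR n _ _)); lia.
Qed.

Lemma mirror_gen d : 0 < d < n -> mirror (gen n d) = gen n (n - d).
Proof.
move=> dn; rewrite mirror_cycL; last by lia.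
apply: posn_ext => a an; rewrite posn_cycR ?posn_cycL /cL /cR; try lia.
by split_ifs; lia.
Qed.

Lemma mirror_block_swap x r y : x <= r <= y -> y <= n ->
  mirror (block_swap n x r y) = block_swap n (n - y) (n - r) (n - x).
Proof.
move=> xry yn; apply: posn_ext => a an.
rewrite posn_mirror an !posn_block_swap /blk; try lia.
by split_ifs; lia.
Qed.

Lemma mirror_root lo hi r : hi <= n -> mid_root M lo hi r ->
  mid_root mirror_order (n - hi) (n - lo) (n - r).
Proof.
move=> hn [lrh K1 K2]; split; first by lia.
  move=> i ih; rewrite /= /mirror_le mirror_gen; last by lia.
  rewrite mirror_cycR; last by lia.
  have -> : n - (n - r) = r by lia.
  have -> : n.-1 - (n - r) = r.-1 by lia.
  by apply: K2; lia.
move=> k kh; rewrite /= /mirror_le mirror_gen; last by lia.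
rewrite mirror_cycL; last by lia.
have -> : n - (n - r) = r by lia.
have -> : n.-1 - (n - r).-1 = r by lia.
by apply: K1; lia.
Qed.
End Mirror.

(** * Existence and uniqueness of roots *)

Section RootExists.
Variables (n : nat) (M : middle_order n).
Notation "x <<= y" := (mid_le M x y) (at level 70).

Lemma root_right_extend lo hi rho : hi <= n -> mid_root M lo.+1 hi hi.-1 ->
  mid_root M lo hi.-1 rho -> lo.+1 < rho -> gen n hi.-1 <<= cycR n lo hi.-1.
Proof.
move=> hn R2 R1 lr; have [h1 _ _] := R1; have [h2 _ _] := R2.
have := @root_left_extend _ (mirror_order M) (n - hi) (n - lo) (n - rho).
have -> : (n - lo).-1 = n - lo.+1 by lia.
have <- : n - hi.-1 = (n - hi).+1 by lia.
move=> H; have := H _ (mirror_root _ R2) (mirror_root _ R1) _.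
rewrite /= /mirror_le mirror_gen; last by lia.
rewrite mirror_cycL; last by lia.
have -> : n - (n - hi.-1) = hi.-1 by lia.
have -> : n.-1 - (n - lo.+1) = lo by lia.
have -> : n.-1 - (n - hi) = hi.-1 by lia.
by apply; lia.
Qed.

Lemma mid_rootS lo hi lo' hi' r : lo <= lo' -> hi' <= hi -> lo' < r < hi' ->
  mid_root M lo hi r -> mid_root M lo' hi' r.
Proof. by move=> h1 h2 h3 [_ K1 K2]; split=> // [i ih|k kh]; [apply: K1|apply: K2]; lia. Qed.

Lemma mid_root_uniq lo hi r r' : hi <= n -> r < r' ->
  mid_root M lo hi r -> mid_root M lo hi r' -> False.
Proof.
move=> hn rr' [h K1 K2] [h' K1' K2'].
suff : r = r' by lia.
apply: (@common_gen_uniq _ M r.-1 r'); try lia.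
- by have := @gen_cycR _ M r.-1 r'; have -> : r.-1.+1 = r; [lia|apply; lia].
- by apply: K2; lia.
- by apply: K1'; lia.
by apply: gen_cycL; lia.
Qed.

(** [r1] lacks only the condition for [k = hi - 1], and [r2] only the one for [i = lo]. If
    [r1 > lo + 1] and [r2 < hi - 1], both are roots of [lo + 1, hi - 1), hence equal, and together
    meet all conditions. If only one of them is extremal, an extension lemma completes it. If both
    are, the atom common to the two long cycles decides. *)
Lemma mid_root_exists lo hi : lo.+1 < hi <= n -> exists r, mid_root M lo hi r.
Proof.
move: {-1}(hi - lo) (erefl (hi - lo)) => m.
elim: m lo hi => [|m IH] lo hi mE lhn; first by lia.
case: (ltnP lo.+2 hi) => hi2; last first.
  exists lo.+1; split; first by lia.
    move=> i ih; have -> : i = lo by lia.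
    by apply: gen_cycR; lia.
  move=> k kh; have -> : k = lo.+1 by lia.
  by apply: gen_cycL; lia.
have [||r1 R1] := IH lo hi.-1; try lia.
have [||r2 R2] := IH lo.+1 hi; try lia.
have [h1 K1 K2] := R1; have [h2 K1' K2'] := R2.
have left_root : gen n lo.+1 <<= cycL n lo hi.-1 -> r1 = lo.+1 ->
    mid_root M lo hi lo.+1.
  move=> gL r1E; subst r1; split; first by lia.
    by move=> i ih; apply: K1; lia.
  move=> k kh; case: (eqVneq k hi.-1) => [->|ne] //.
  by apply: K2; lia.
have right_root : gen n hi.-1 <<= cycR n lo hi.-1 -> r2 = hi.-1 ->
    mid_root M lo hi hi.-1.
  move=> gR r2E; subst r2; split; first by lia.
    move=> i ih; case: (eqVneq i lo) => [->|ne] //.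
    by apply: K1'; lia.
  by move=> k kh; apply: K2'; lia.
case: (eqVneq r1 lo.+1) => [r1E|n1].
  case: (eqVneq r2 hi.-1) => [r2E|n2].
    have [|d [dh dR dL]] := @common_gen _ M lo hi.-1; first by lia.
    case: (eqVneq d lo.+1) => [dE|d1].
      by rewrite dE in dL; exists lo.+1; apply: left_root.
    case: (eqVneq d hi.-1) => [dE|d2].
      by rewrite dE in dR; exists hi.-1; apply: right_root.
    (* For [d] strictly between, [gen n d] and [gen n lo.+1] would be two atoms below both
       [cycR n lo d] and [cycL n lo d]. *)
    have dR' : gen n d <<= cycR n lo d by apply: gen_cycR_restrict dR; lia.
    suff : lo.+1 = d by lia.
    apply: (@common_gen_uniq _ M lo d); try lia => //.
    - by apply: gen_cycR; lia.
    - by have := K2 d; rewrite r1E; apply; lia.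
    by apply: gen_cycL; lia.
  exists lo.+1; apply: left_root => //.
  by rewrite r1E in R1; apply: root_left_extend R1 R2 _; lia.
case: (eqVneq r2 hi.-1) => [r2E|n2].
  exists hi.-1; apply: right_root => //.
  by rewrite r2E in R2; apply: root_right_extend R2 R1 _; lia.
have S1 : mid_root M lo.+1 hi.-1 r1 by apply: mid_rootS R1; lia.
have S2 : mid_root M lo.+1 hi.-1 r2 by apply: mid_rootS R2; lia.
case: (ltngtP r1 r2) => [lt|lt|E]; [by case: (mid_root_uniq _ lt S1 S2); lia| |].
  by case: (mid_root_uniq _ lt S2 S1); lia.
exists r1; split; first by lia.
  by move=> i ih; apply: K1; lia.
by subst r2 => k kh; apply: K2'; lia.
Qed.
End RootExists.

(** * Generators and block exchanges *)

Section LeftMultiplication.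
Variable n : nat.
Implicit Types (v w : 'S_n).

Lemma posn_mul v w a : posn (v * w)%g a = posn v (posn w a).
Proof.
case: (ltnP a n) => an; last by rewrite !posn_out // posn_out.
by rewrite -[a]/(val (Ordinal an)) !posnE invMg permM.
Qed.

Lemma posn_mul_gen v d a : 0 < d < n -> posn (v * gen n d)%g a = posn v (cL d.-1 d a).
Proof. by move=> dn; rewrite posn_mul posn_cycL //; lia. Qed.

Lemma posn_gen d a : 0 < d < n -> posn (gen n d) a = cL d.-1 d a.
Proof. by move=> dn; rewrite posn_cycL //; lia. Qed.

Lemma cL_gen d a : 0 < d -> cL d.-1 d (cL d.-1 d a) = a.
Proof. by move=> d0; rewrite [cL d.-1 d a]/cL; split_ifs; rewrite /cL; split_ifs; lia. Qed.

Lemma ell_mul_gen v d : 0 < d < n -> posn v d.-1 < posn v d ->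
  ell (v * gen n d)%g = (ell v).+1.
Proof.
move=> dn lt; rewrite !card_vinv.
pose g : 'S_n := gen n d.
have gE (a : 'I_n) : ((g^-1)%g a : nat) = cL d.-1 d a by rewrite -posnE posn_gen.
have inj : injective (fun p : 'I_n * 'I_n => ((g^-1)%g p.1, (g^-1)%g p.2)).
  by move=> [a b] [c e] [/perm_inj -> /perm_inj ->].
have d1n : d.-1 < n by lia.
have dn' : d < n by lia.
pose p0 := (Ordinal d1n, Ordinal dn').
rewrite -[in RHS](card_imset _ inj).
have -> : vinv (v * gen n d)%g = p0 |: [set ((g^-1)%g p.1, (g^-1)%g p.2) | p in vinv v].
  apply/setP => -[a b]; rewrite !inE /= !posn_mul_gen //.
  apply/idP/orP => [h|[/eqP[-> ->] /=|/imsetP[[a' b'] /[!inE] /= h [-> ->]]]].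
  - case: (boolP ((a == Ordinal d1n) && (b == Ordinal dn'))) => [/andP[/eqP -> /eqP ->]|ne].
      by left.
    right; apply/imsetP; exists ((g^-1)%g a, (g^-1)%g b).
      rewrite inE /= !gE; move: h ne; rewrite -!val_eqE /= => h ne.
      have [] : cL d.-1 d a < cL d.-1 d b /\ posn v (cL d.-1 d b) < posn v (cL d.-1 d a).
        split; last by lia.
        by move: h ne; rewrite /cL; split_ifs; lia.
      by lia.
    by congr pair; apply/val_inj; rewrite /= !gE cL_gen //; lia.
  - have -> : cL d.-1 d d = d.-1 by rewrite /cL eqxx.
    have -> : cL d.-1 d d.-1 = d by rewrite /cL; split_ifs; lia.
    by lia.
  rewrite !gE !cL_gen; try lia.
  have h' : ~ (val a' = d.-1 /\ val b' = d).
    by move=> [/= e1 e2]; rewrite e1 e2 in h; lia.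
  rewrite /= in h'; have : cL d.-1 d a' < cL d.-1 d b' by rewrite /cL; split_ifs; lia.
  by lia.
rewrite cardsU1 (_ : p0 \notin _) //; apply/imsetP => -[[a b]].
rewrite inE /= => h [e1 e2].
have := congr1 val e1; have := congr1 val e2; rewrite /= !gE /cL; split_ifs; lia.
Qed.

(** [cnt v p r] is at least [hi - r], while in [w] only the values in [r, hi) can contribute to the
    count, so all of them must. *)
Lemma bruhat_fill lo hi r p v w : bruhat_le v w -> supported lo hi w -> p <= hi <= n ->
  (forall b, r <= b < hi -> posn v b < p) -> forall b, r <= b < hi -> posn w b < p.
Proof.
move=> bru sw ph H b bh; rewrite ltnNge; apply/negP => pb.
have := bruhat_cnt p r bru; rewrite leqNgt => /negP; apply.
have bn : b < n by lia.
apply: leq_trans (_ : \sum_(i < n) ((i != Ordinal bn) && (r <= i < hi)) < _).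
  rewrite ltnS; apply: leq_sum => i _; rewrite -val_eqE /=.
  have := sw i; case: (eqVneq (val i) b) => [e|ne] /=; last by lia.
  by rewrite /= in e; rewrite e; lia.
rewrite (bigD1 (Ordinal bn)) //= eqxx /= add0n /cnt.
rewrite [X in _ < X](bigD1 (Ordinal bn)) //= H //.
have -> : r <= b by lia.
rewrite add1n ltnS; apply: leq_sum => i _; have := H i; lia.
Qed.
End LeftMultiplication.

Section Shuffles.
Variables (n : nat).
Notation bs := (block_swap n).

(* The shuffle in which all of [r, y) precedes [lo, r), and y precedes [x, r). *)
Definition shf (lo r y x a : nat) : nat :=
  if lo <= a < x then a + (y - r) else if x <= a < r then (a + (y - r)).+1
  else if r <= a < y then a - (r - lo) else if a == y then y - (r - x) else a.

Definition shuffle lo r y x : 'S_n := mkpos n (shf lo r y x).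

Lemma posn_shuffle lo r y x a : lo <= x <= r -> r <= y < n ->
  posn (shuffle lo r y x) a = shf lo r y x a.
Proof.
move=> h1 h2; apply: posn_mkpos; split=> [? ?|? ?|? ?]; rewrite /shf; split_ifs; lia.
Qed.

Lemma shuffle_full lo r y : lo <= r <= y -> y < n -> shuffle lo r y lo = bs lo r y.+1.
Proof.
move=> h1 h2; apply: posn_ext => a an; rewrite posn_shuffle ?posn_block_swap /shf /blk; try lia.
by split_ifs; lia.
Qed.

Lemma shuffle_start lo r y : lo <= r <= y -> y < n -> shuffle lo r y r = bs lo r y.
Proof.
move=> h1 h2; apply: posn_ext => a an; rewrite posn_shuffle ?posn_block_swap /shf /blk; try lia.
by split_ifs; lia.
Qed.

Lemma supported_shuffle lo r y x : lo <= x <= r -> r <= y < n ->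
  supported lo y.+1 (shuffle lo r y x).
Proof. by move=> h1 h2 a na; rewrite posn_shuffle // /shf; split_ifs; lia. Qed.

Lemma ell_shuffle lo r y x : lo <= x <= r -> r <= y < n ->
  ell (shuffle lo r y x) = (r - lo) * (y - r) + (r - x).
Proof.
move=> h1 h2; rewrite card_vinv.
have e1 : #|rect n lo r r y| = (r - lo) * (y - r) by rewrite card_rect; lia.
have e2 : #|rect n x r y y.+1| = r - x by rewrite card_rect; lia.
rewrite -e1 -e2 -cardsUI [X in _ + X](_ : _ = 0) ?addn0; last first.
  apply/eqP; rewrite cards_eq0; apply/eqP/setP => -[a b]; rewrite !inE /=; lia.
apply: eq_card => -[a b]; rewrite !inE /= !posn_shuffle // /shf; split_ifs; lia.
Qed.
End Shuffles.

Section GeneratorJoins.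
Variables (n : nat) (M : middle_order n).
Implicit Types (u v w : 'S_n).
Notation "x <<= y" := (mid_le M x y) (at level 70).
Notation meet := (mid_meet M).
Notation join := (mid_join M).
Notation bs := (block_swap n).

Lemma gen_not_le1 d : 0 < d < n -> ~ gen n d <<= 1%g.
Proof.
move=> dn h; have := mid_le_ell_eq h; rewrite ell1 ell_gen // => /(_ isT).
by move/(congr1 (fun w => ell w)); rewrite ell1 ell_gen.
Qed.

(** An atom of a distributive lattice is join-prime: its meets with [u] and [v] cannot both be
    trivial. *)
Lemma gen_prime d u v : 0 < d < n -> gen n d <<= join u v -> gen n d <<= u \/ gen n d <<= v.
Proof.
move=> dn le; have dE w : meet w (gen n d) = gen n d \/ meet w (gen n d) = 1%g.
  case: (eqVneq (meet w (gen n d)) (gen n d)) => [|ne]; [by left|right].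
  have := mid_le_ell (mid_meet_r M w (gen n d)) ne; rewrite ell_gen // ltnS leqn0 => /eqP e0.
  apply/esym/(@mid_le_ell_eq _ M); first exact: mid_le1.
  by rewrite e0.
have := mid_meetUl M u v (gen n d).
case: (dE u) => [<- _|uE]; first by left; exact: mid_meet_l.
case: (dE v) => [<- _|vE]; first by right; exact: mid_meet_l.
rewrite uE vE => e; case: (gen_not_le1 dn).
have -> : 1%g = join 1%g 1%g.
  by apply: (@mid_le_anti _ M); [exact: mid_join_l|apply: mid_join_le; exact: mid_lexx].
by rewrite -e; apply: mid_le_meet => //; exact: mid_lexx.
Qed.

(* The join of [gen x] and the block exchange has one more inversion than the latter. Depending on
   the value [b] at its first position, it is the product on the right, or it lies above
   [cycL (x - 1) b], and then [cycR (x - 1) b] and [cycL (x - 1) b] share two generators. *)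
Lemma gen_block_swap_small lo hi r x y : hi <= n -> mid_root M lo hi r ->
  lo < x < r -> r < y <= hi -> bs x r y <<= (bs x r y * gen n x)%g.
Proof.
move=> hn [rh K1 K2] xh yh.
have xn : 0 < x < n by lia.
set u := bs x r y; pose kap := join (gen n x) u.
have ku : u <<= kap by exact: mid_join_r.
have kg : gen n x <<= kap by exact: mid_join_l.
have eu : ell u = (r - x) * (y - r) by rewrite ell_block_swap; lia.
have su : supported x y u by apply: supported_block_swap; lia.
have sg : supported x.-1 x.+1 (gen n x) by apply: supported_cycL; lia.
have ek : ell kap = (ell u).+1.
  have I1 : meet (gen n x) u = 1%g by apply: (mid_meet_trivial M _ _ _ sg su); lia.
  by rewrite (mid_meet_eq1 I1) (ell_gen xn).
have sk : supported x.-1 y kap.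
  by apply: mid_join_supported; [lia|apply: supportedW sg; lia|apply: supportedW su; lia].
have [||b bh pb] := mid_cycL_pos _ _ sk kg; try lia.
have kr a := @supported_range _ _ _ _ a sk.
have kinj a c := @posn_inj _ kap a c.
case: (leqP r b) => [rb|br].
  pose c := cycL n x.-1 b.
  have ck : c <<= kap.
    apply/mid_weak/weak_cycL; first by lia.
    by move=> a ai; rewrite pb; have := kr a; have := kinj a b; lia.
  have ncu : ~ c <<= u.
    move=> cu; have := mid_supported _ cu su; have sx : x <= y <= n by lia.
    by move=> /(_ sx)/(_ x.-1); rewrite posn_cycL /cL; [split_ifs; lia|lia|lia].
  have kE : kap = join u c by apply: mid_cover_join; rewrite ?ek.
  have [gu|gc] : gen n x <<= u \/ gen n x <<= c by apply: gen_prime; rewrite -?kE.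
    by have := @mid_gen_range _ M x y x _ _ _ gu su; lia.
  suff : x = r by lia.
  apply: (@common_gen_uniq _ M x.-1 b); try lia => //.
  - by have := @gen_cycR _ M x.-1 b; have -> : x.-1.+1 = x; [lia|apply; lia].
  - exact: gc.
  - apply: mid_le_trans (K1 x.-1 _) _; first by lia.
    by apply: cycR_weak; lia.
  apply: mid_le_trans (K2 b _) _; first by lia.
  by apply: cycL_weak; lia.
have fill c : r <= c < y -> posn kap c < x + (y - r).
  apply: (bruhat_fill (mid_bruhat ku) sk); first by lia.
  by move=> e eh; rewrite posn_block_swap /blk; try lia; split_ifs; lia.
(* Pigeonhole: the positions from [x - 1] up to [x + (y - r)], excluded, are already filled by [b]
   and the [y - r] large values. *)
have late a : x.-1 <= a < r -> a != b -> x + (y - r) <= posn kap a.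
  move=> ah ab; rewrite leqNgt; apply/negP => lt.
  have := @card_posn_itv _ kap x.-1 (x + (y - r)); have -> : x + (y - r) <= n by lia.
  move/(_ isT) => cE.
  have an : a < n by lia.
  have bn : b < n by lia.
  pose B := [set i : 'I_n | r <= i < y].
  have cB : #|B| = y - r.
    have n0 : 0 < n by lia.
    have := @card_posn_itv n 1%g r y; have -> : y <= n by lia.
    by move=> /(_ isT) <-; apply: eq_card => i; rewrite !inE posn1.
  have cab : #|[set Ordinal an; Ordinal bn]| = 2 by rewrite cards2 -val_eqE /= ab.
  have : #|B :|: [set Ordinal an; Ordinal bn]| <= x + (y - r) - x.-1.
    rewrite -cE; apply: subset_leq_card; apply/subsetP => i; rewrite !inE -!val_eqE /=.
    move=> h; have f1 := kr i; have f2 := fill i.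
    have [e|[e|e]] : r <= i < y \/ val i = a \/ val i = b by rewrite /=; lia.
    - by lia.
    - by rewrite /= in e; rewrite e; have := kr a; lia.
    by rewrite /= in e; rewrite e; lia.
  have := cardsUI B [set Ordinal an; Ordinal bn].
  rewrite cB cab (_ : B :&: _ = set0) ?cards0; first by lia.
  by apply/setP => i; rewrite !inE -!val_eqE /=; lia.
have bx : b = x.
  apply/eqP; apply: contraT => nbx.
  (* If [b > x], the small values other than [b] follow all large ones, which makes [ell u]
     inversions, and [b] precedes [x - 1] and [x]: one too many for [ell kap]. *)
  pose A := [set p : 'I_n * 'I_n | (x.-1 <= p.1 < r) && (val p.1 != b) && (r <= p.2 < y)].
  have cA : #|A| + (y - r) = (r - x.-1) * (y - r).
    have <- : #|rect n x.-1 r r y| = (r - x.-1) * (y - r) by rewrite card_rect; lia.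
    have <- : #|rect n b b.+1 r y| = y - r by rewrite card_rect; lia.
    rewrite -cardsUI [X in _ + X](_ : _ = 0) ?addn0.
      by apply: eq_card => -[a c]; rewrite !inE /=; lia.
    by apply/eqP; rewrite cards_eq0; apply/eqP/setP => -[a c]; rewrite !inE /=; lia.
  have cB : #|rect n x.-1 x.+1 b b.+1| = 2 by rewrite card_rect; lia.
  have : #|A :|: rect n x.-1 x.+1 b b.+1| <= ell kap.
    rewrite card_vinv; apply: subset_leq_card; apply/subsetP => -[a c]; rewrite !inE /=.
    case/orP => h.
      by have := fill c; have := late a; lia.
    have -> : (c : nat) = b by lia.
    by rewrite pb; have := kr a; have := kinj a b; lia.
  have := cardsUI A (rect n x.-1 x.+1 b b.+1).
  rewrite (_ : A :&: _ = set0) ?cards0; last first.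
    by apply/setP => -[a c]; rewrite !inE /=; lia.
  by rewrite ek eu cB; move: cA; have -> : r - x.-1 = (r - x).+1 by [lia]; lia.
subst b; suff -> : (u * gen n x)%g = kap by [].
apply: (mid_le_ell_eq (M := M)).
  apply/mid_weak/right_weakP => a c ac; rewrite !posn_mul_gen // !posn_block_swap; try lia.
  move=> h.
  have [[-> ->]|[h1 [h2 h3]]] : (a = x.-1 /\ c = x) \/ (x.-1 <= a < r /\ a <> x /\ r <= c < y).
  - by move: h; rewrite /cL; split_ifs; rewrite /blk; split_ifs; lia.
  - by rewrite pb; have := kr x.-1; have := kinj x.-1 x; lia.
  by have := fill c; have := late a; lia.
rewrite ek ell_mul_gen //; rewrite !posn_block_swap /blk; try lia.
by split_ifs; lia.
Qed.
End GeneratorJoins.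

Lemma blk_inv x r y a b : x <= r <= y -> a < b ->
  (blk x r y b < blk x r y a) = (x <= a < r) && (r <= b < y).
Proof. by move=> xry ab; rewrite /blk; split_ifs; lia. Qed.

Lemma shf_inv lo r y x a b : lo <= x <= r -> r <= y -> a < b ->
  (shf lo r y x b < shf lo r y x a) =
  (lo <= a < r) && (r <= b < y) || (x <= a < r) && (b == y).
Proof. by move=> lxr ry ab; rewrite /shf; split_ifs; lia. Qed.

(** * The interval below the block exchange of a root *)

Section RootComplement.
Variables (n : nat) (M : middle_order n).
Implicit Types (u v w : 'S_n).
Notation "x <<= y" := (mid_le M x y) (at level 70).
Notation meet := (mid_meet M).
Notation join := (mid_join M).
Notation bs := (block_swap n).

Lemma gen_block_swap_big lo hi r x y : hi <= n -> mid_root M lo hi r ->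
  lo <= x < r -> r < y < hi -> bs x r y <<= (bs x r y * gen n y)%g.
Proof.
move=> hn R xh yh; have [rh _ _] := R.
have := @gen_block_swap_small _ (mirror_order M) (n - hi) (n - lo) (n - r) (n - y) (n - x).
have mul v w : mirror (v * w)%g = (mirror v * mirror w)%g.
  have -> : (v * w)%g = mirror (mirror v * mirror w)%g.
    apply: posn_ext => a an; rewrite posn_mirror an [in LHS]posn_mul [in RHS]posn_mul !posn_mirror.
    have -> : n.-1 - a < n by lia.
    have := posn_lt w a; rewrite an => wn.
    have -> : n.-1 - (n.-1 - a) = a by lia.
    have -> : n.-1 - posn w a < n by lia.
    have -> : n.-1 - (n.-1 - posn w a) = posn w a by lia.
    by have := posn_lt v (posn w a); lia.
  by rewrite mirrorK.
move=> H; have := H _ (mirror_root _ R) _ _.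
rewrite /= /mirror_le mul !mirror_block_swap; try lia.
rewrite mirror_gen; last by lia.
have -> : n - (n - x) = x by lia.
have -> : n - (n - y) = y by lia.
have -> : n - (n - r) = r by lia.
by apply; lia.
Qed.

Section IntervalRoot.
Variables lo hi r : nat.
Hypotheses (hn : hi <= n) (root : mid_root M lo hi r).

Let rh : lo < r < hi. Proof. by case: root. Qed.

(** In effect the shuffle is the join of the two block exchanges. Lowering [x] by one adds one to
    the length, so it is enough that [bs x r y.+1] is not below the previous shuffle: Bruhat order
    would want [y] at a position less than [x + (y + 1 - r)], and it stands exactly there. *)
Lemma shuffle_le_upper x y z : lo <= x <= r -> r <= y < hi ->
  bs lo r y <<= z -> bs x r y.+1 <<= z -> shuffle n lo r y x <<= z.
Proof.
move=> xh yh z1; move: {-1}(r - x) (erefl (r - x)) => m.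
elim: m x xh => [|m IH] x xh mE z2.
  have -> : x = r by lia.
  by rewrite shuffle_start //; lia.
have z3 : bs x.+1 r y.+1 <<= z.
  apply: mid_le_trans z2; apply/mid_weak/right_weakP => a b ab.
  by rewrite !posn_block_swap ?blk_inv; lia.
have z4 : shuffle n lo r y x.+1 <<= z by apply: IH => //; lia.
suff -> : shuffle n lo r y x = join (shuffle n lo r y x.+1) (bs x r y.+1).
  exact: mid_join_le.
apply: mid_cover_join.
- apply/mid_weak/right_weakP => a b ab.
  by rewrite !posn_shuffle ?shf_inv; lia.
- apply/mid_weak/right_weakP => a b ab.
  by rewrite !posn_shuffle ?posn_block_swap ?shf_inv ?blk_inv; try lia;
     rewrite !posn_block_swap ?blk_inv; lia.
- move/mid_bruhat => bru.
  have sS : supported lo y.+1 (shuffle n lo r y x.+1) by apply: supported_shuffle; lia.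
  have := @bruhat_fill n lo y.+1 r (x + (y.+1 - r)) _ _ bru sS _ _ y.
  rewrite posn_shuffle /shf; try lia.
  move=> H; suff : y - (r - x.+1) < x + (y.+1 - r) by lia.
  move: H; have -> : (lo <= y < x.+1) = false by lia.
  have -> : (x.+1 <= y < r) = false by lia.
  rewrite ltnn andbF eqxx; apply; try lia.
  by move=> b bh; rewrite posn_block_swap /blk; try lia; split_ifs; lia.
by rewrite !ell_shuffle; lia.
Qed.

Lemma weak_mul v w t : 0 < t < n ->
    (forall a b, a < b -> posn v b < posn v a -> posn w b < posn w a) ->
    posn w t.-1 < posn w t ->
  mid_le M (v * gen n t)%g (w * gen n t)%g.
Proof.
move=> tn H lt; apply/mid_weak/right_weakP => a b ab; rewrite !posn_mul_gen //.
case: (boolP ((a == t.-1) && (b == t))) => [/andP[/eqP -> /eqP ->] _|h].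
  have -> : cL t.-1 t t = t.-1 by rewrite /cL eqxx.
  by have -> : cL t.-1 t t.-1 = t by rewrite /cL; split_ifs; lia.
by apply: H; rewrite /cL; split_ifs; lia.
Qed.

(** By [shuffle_le_upper] only two block exchanges need comparing with the product. Weak order
    settles this except at the block boundaries [t = y] and [t = x], where the root is needed. *)
Lemma shuffle_mul_gen x y t : lo <= x <= r -> r <= y < hi -> lo < t <= y -> t != r ->
  shuffle n lo r y x <<= (shuffle n lo r y x * gen n t)%g.
Proof.
move=> xh yh th tr; apply: shuffle_le_upper => //.
  case: (eqVneq t y) => [ty|ty].
    apply: mid_le_trans (gen_block_swap_big (x := lo) (y := y) hn root _ _) _; try lia.
    subst t; apply: weak_mul => [|a b ab|]; first by lia.
      rewrite !posn_block_swap; try lia; rewrite blk_inv; try lia.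
      by rewrite !posn_shuffle; try lia; rewrite shf_inv; lia.
    by rewrite !posn_shuffle; try lia; rewrite /shf; split_ifs; lia.
  apply/mid_weak/right_weakP => a b ab; rewrite !posn_block_swap; try lia.
  rewrite blk_inv; try lia; move=> h.
  rewrite !posn_mul_gen ?posn_shuffle; try lia; rewrite ?posn_shuffle; try lia.
  have [h1 h2] : lo <= cL t.-1 t a < r /\ r <= cL t.-1 t b < y by rewrite /cL; split_ifs; lia.
  by rewrite shf_inv; lia.
case: (eqVneq t x) => [tx|tx].
  apply: mid_le_trans (gen_block_swap_small (x := x) (y := y.+1) hn root _ _) _; try lia.
  subst t; apply: weak_mul => [|a b ab|]; first by lia.
    rewrite !posn_block_swap; try lia; rewrite blk_inv; try lia.
    by rewrite !posn_shuffle; try lia; rewrite shf_inv; lia.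
  by rewrite !posn_shuffle; try lia; rewrite /shf; split_ifs; lia.
apply/mid_weak/right_weakP => a b ab; rewrite !posn_block_swap; try lia.
rewrite blk_inv; try lia; move=> h.
rewrite !posn_mul_gen ?posn_shuffle; try lia; rewrite ?posn_shuffle; try lia.
have [h1 h2] : x <= cL t.-1 t a < r /\ r <= cL t.-1 t b < y.+1 by rewrite /cL; split_ifs; lia.
by rewrite shf_inv; lia.
Qed.

(** Otherwise [W] is the join of [V] and [gen n t], hence below the product of the two and equal to
    it by length; but [t - 1] precedes [t] in [W] and not in the product. *)
Lemma gen_shuffle_step x y t : lo <= x < r -> r <= y < hi -> 0 < t < n -> t != r ->
  ~ gen n t <<= shuffle n lo r y x.+1 -> ~ gen n t <<= shuffle n lo r y x.
Proof.
move=> xh yh tn tr nt1 t0.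
set V := shuffle n lo r y x.+1 in nt1; set W := shuffle n lo r y x in t0.
have sW : supported lo y.+1 W by apply: supported_shuffle; lia.
have th : lo < t < y.+1 by apply: mid_gen_range t0 sW => //; lia.
have lt : posn V t.-1 < posn V t.
  by rewrite /V !posn_shuffle /shf; try lia; split_ifs; lia.
have ltW : posn W t.-1 < posn W t.
  by rewrite /W !posn_shuffle /shf; try lia; split_ifs; lia.
have VW : V <<= W.
  apply/mid_weak/right_weakP => a b ab; rewrite /V /W !posn_shuffle; try lia.
  by rewrite !shf_inv; lia.
have WE : W = join V (gen n t).
  by apply: mid_cover_join => //; rewrite /V /W !ell_shuffle; lia.
have W1 : W <<= (V * gen n t)%g.
  rewrite WE; apply: mid_join_le; first by apply: shuffle_mul_gen; lia.
  apply/mid_weak/right_weak_gen; first by lia.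
  rewrite !posn_mul_gen //.
  have -> : cL t.-1 t t = t.-1 by rewrite /cL eqxx.
  have -> : cL t.-1 t t.-1 = t by rewrite /cL; split_ifs; lia.
  by [].
have E : W = (V * gen n t)%g.
  apply: mid_le_ell_eq W1 _; rewrite ell_mul_gen // /V /W !ell_shuffle; lia.
have := congr1 (fun w => posn w t) E; have := congr1 (fun w => posn w t.-1) E.
rewrite !posn_mul_gen //.
have -> : cL t.-1 t t = t.-1 by rewrite /cL eqxx.
have -> : cL t.-1 t t.-1 = t by rewrite /cL; split_ifs; lia.
by lia.
Qed.

(** Shuffles build the block exchange from the identity one inversion at a time: for each [y], [x]
    runs from [r] down to [lo]. No step lets [gen n t] in. *)
Lemma gen_not_le_block_swap y t : r <= y <= hi -> 0 < t < n -> t != r ->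
  ~ gen n t <<= bs lo r y.
Proof.
move=> yh tn tr; move: {-1}(y - r) (erefl (y - r)) => m.
elim: m y yh => [|m IH] y yh mE.
  have -> : y = r by lia.
  move=> h; have s : supported lo lo.+1 (bs lo r r).
    by move=> a _; rewrite posn_block_swap /blk; try lia; split_ifs; lia.
  have := @mid_gen_range _ M lo lo.+1 t _ _ _ h s; lia.
case: y yh mE => [|y] yh mE; first by lia.
have step k : k <= r - lo -> ~ gen n t <<= shuffle n lo r y (r - k).
  elim: k => [|k IHk] kr; first by rewrite subn0 shuffle_start; [apply: IH|..]; lia.
  apply: gen_shuffle_step; try lia.
  have -> : (r - k.+1).+1 = r - k by lia.
  by apply: IHk; lia.
have := step (r - lo); rewrite subKn; last by lia.
by rewrite shuffle_full; try lia; apply.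
Qed.

(** No atom but [gen n r] can lie below [w], so each block stays increasing in [w]; its inversions
    pair a small value with a large one, and the block exchange has all such pairs. *)
Lemma le_block_swap w : w <<= bs lo r hi <-> right_weak_le w (bs lo r hi).
Proof.
split=> [le|]; last exact: mid_weak.
have su : supported lo hi (bs lo r hi) by apply: supported_block_swap; lia.
have sw : supported lo hi w by apply: mid_supported le su; lia.
have asc a : a.+1 < n -> a.+1 != r -> posn w a < posn w a.+1.
  move=> an ar; rewrite ltn_neqAle; apply/andP; split.
    by apply/eqP => /posn_inj; lia.
  rewrite leqNgt; apply/negP => lt.
  apply: (@gen_not_le_block_swap hi a.+1) => //; first by lia.
  by apply: mid_le_trans le; apply/mid_weak/right_weak_gen.
have mono a k : a + k < n -> (r <= a) || (a + k < r) -> posn w a <= posn w (a + k).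
  elim: k => [|k IH] h1 h2; first by rewrite addn0.
  by have := asc (a + k); have := IH; rewrite addnS in h1 h2 *; lia.
apply/right_weakP => a b ab ba; rewrite !posn_block_swap; try lia.
have := mono a (b - a); rewrite subnKC; last by lia.
have := sw a; have := sw b; have := @supported_range _ _ _ _ a sw.
have := @supported_range _ _ _ _ b sw; rewrite /blk; split_ifs; lia.
Qed.

Lemma root_complement :
  [/\ meet (interval_rev n lo r) (interval_rev n r hi) = 1%g,
      meet (join (interval_rev n lo r) (interval_rev n r hi)) (bs lo r hi) = 1%g &
      join (join (interval_rev n lo r) (interval_rev n r hi)) (bs lo r hi) =
        interval_rev n lo hi].
Proof.
have s1 : supported lo r (interval_rev n lo r) by apply: supported_interval_rev; lia.
have s2 : supported r hi (interval_rev n r hi) by apply: supported_interval_rev; lia.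
have s3 : supported lo hi (bs lo r hi) by apply: supported_block_swap; lia.
have I1 : meet (interval_rev n lo r) (interval_rev n r hi) = 1%g.
  apply: (@mid_meet_trivial _ M lo r.-1 hi); try lia.
    by apply: supportedW s1; lia.
  by apply: supportedW s2; lia.
set c := join _ _ in I1 *.
have I2 : meet c (bs lo r hi) = 1%g.
  (* An atom below the meet would be [gen n r], by the block exchange; but [gen n r] is supported on
     neither half, so by primality it is not below their join. *)
  apply/eqP; apply: contraT => /(@mid_gen _ M)[d dn dm].
  have dc := mid_le_trans dm (mid_meet_l M _ _).
  have db := mid_le_trans dm (mid_meet_r M _ _).
  case: (eqVneq d r) => [dr|dr]; last first.
    by case: (@gen_not_le_block_swap hi d _ dn dr db); lia.
  case: (gen_prime dn dc) => h.
    by have := @mid_gen_range _ M lo r d _ _ dn h s1; lia.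
  by have := @mid_gen_range _ M r hi d _ _ dn h s2; lia.
split=> //; apply: (mid_le_ell_eq (M := M)).
  apply/(mid_le_rev M); first by lia.
  apply: mid_join_supported => //; first by lia.
  by apply: mid_join_supported; [lia|apply: supportedW s1; lia|apply: supportedW s2; lia].
rewrite (mid_meet_eq1 I2) (mid_meet_eq1 I1) (@ell_interval_rev _ lo r hi) //; lia.
Qed.
End IntervalRoot.
End RootComplement.

(** * Boolean steps between box partitions *)

Lemma box_partitionP (a b : nat) (lam : {ffun 'I_a -> 'I_b.+1}) :
  reflect (forall i j : 'I_a, i <= j -> lam j <= lam i) (box_partition lam).
Proof.
apply: (iffP idP) => [/forallP H i j ij|H].
  by have /forallP/(_ j)/implyP := H i; apply.
by apply/forallP => i; apply/forallP => j; apply/implyP; apply: H.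
Qed.

Lemma box_stepP (a b : nat) (lam mu : {ffun 'I_a -> 'I_b.+1}) :
  reflect ((forall i, lam i <= mu i <= (lam i).+1) /\
           (forall i j : 'I_a, i < j -> mu j <= lam i)) (box_step lam mu).
Proof.
apply: (iffP andP) => [[/forallP s1 /forallP s2]|[s1 s2]]; split=> //.
- by move=> i j ij; have /forallP/(_ j)/implyP := s2 i; apply.
- exact/forallP.
by apply/forallP => i; apply/forallP => j; apply/implyP; apply: s2.
Qed.

Lemma ffun_of_nat (a b : nat) (f : 'I_a -> nat) : (forall i, f i <= b) ->
  exists k : {ffun 'I_a -> 'I_b.+1}, forall i, k i = f i :> nat.
Proof.
by move=> fb; exists [ffun i => inord (f i)] => i; rewrite ffunE inordK ?ltnS.
Qed.

Ltac ord_lia :=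
  repeat match goal with |- context [nat_of_ord ?i] => generalize (nat_of_ord i) end;
  clear; lia.

Section BoxLattice.
Local Open Scope order_scope.
Variables (d : Order.disp_t) (L : finDistrLatticeType d) (e u : L).
Variables (a b : nat).
Variables (lam : L -> {ffun 'I_a -> 'I_b.+1}) (inv : {ffun 'I_a -> 'I_b.+1} -> L).
Hypotheses (e_le : forall x, e <= x)
  (lam_part : forall x, x <= u -> box_partition (lam x))
  (lam_le : forall x y, x <= u -> y <= u ->
     (x <= y) <-> (forall i, (lam x i <= lam y i)%N))
  (inv_le : forall k, box_partition k -> inv k <= u)
  (invK : forall k, box_partition k -> lam (inv k) = k).

Lemma lamK x : x <= u -> inv (lam x) = x.
Proof.
move=> xu; have lp := lam_part xu; apply/le_anti/andP.
by split; apply/lam_le; rewrite ?invK ?inv_le.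
Qed.

Lemma boolean_itv_box x y : x <= u -> y <= u -> boolean_itv x y = box_step (lam x) (lam y).
Proof.
move=> xu yu; have /box_partitionP px := lam_part xu; have /box_partitionP py := lam_part yu.
apply/boolean_itvP/box_stepP => [[xy H]|[s1 s2]]; last first.
  split=> [|z /andP[xz zy]]; first by apply/(lam_le _ _).2 => // i; have /andP[] := s1 i.
  have zu := le_trans zy yu.
  have lxz := (lam_le xu zu).1 xz.
  have lzy := (lam_le zu yu).1 zy.
  have /box_partitionP pz := lam_part zu.
  (* The complement reflects each row of [z] between those of [x] and [y]; the column condition [s2]
     makes the result a partition. *)
  have [|k kE] := @ffun_of_nat a b (fun i => lam x i + lam y i - lam z i)%N.
    by move=> i; have := lxz i; have := lzy i; have := ltn_ord (lam y i); ord_lia.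
  have kp : box_partition k.
    apply/box_partitionP => i j; rewrite leq_eqVlt => /orP[/eqP/val_inj -> //|ij].
    have h1 := s2 _ _ ij; have h2 := lxz i; have h3 := lzy i; have h4 := lxz j.
    by move: h1 h2 h3 h4; rewrite !kE; ord_lia.
  have ku := inv_le kp; have kK := invK kp.
  have xk : x <= inv k by apply/(lam_le _ _).2 => // i; rewrite kK kE; have := lzy i; ord_lia.
  have ky : inv k <= y by apply/(lam_le _ _).2 => // i; rewrite kK kE; have := lxz i; ord_lia.
  exists (inv k); split; first by rewrite xk.
    apply/le_anti; rewrite lexI xz xk !andbT.
    have mu : z `&` inv k <= u := le_trans (leIl _ _) zu.
    apply/(lam_le _ _).2 => // i.
    have := (lam_le mu zu).1 (leIl _ _) i; have := (lam_le mu ku).1 (leIr _ _) i; rewrite kK kE.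
    by have := s1 i; have := lxz i; have := lzy i; ord_lia.
  apply/le_anti; rewrite leUx zy ky /=.
  have ju : z `|` inv k <= u by rewrite leUx zu.
  apply/(lam_le _ _).2 => // i.
  have := (lam_le zu ju).1 (leUl _ _) i; have := (lam_le ku ju).1 (leUr _ _) i; rewrite kK kE.
  by have := s1 i; have := lxz i; have := lzy i; ord_lia.
have lxy := (lam_le xu yu).1 xy.
(* The element obtained by raising rows [0..i] to at least [lam x i + 1]. *)
have raise (i : 'I_a) : (lam x i < lam y i)%N -> exists2 k : {ffun 'I_a -> 'I_b.+1},
    (forall j, k j = (if j <= i then maxn (lam x j) (lam x i).+1 else lam x j) :> nat)%N &
    exists k' : {ffun 'I_a -> 'I_b.+1}, [/\ box_partition k',
     forall j, (minn (k j) (k' j) <= lam x j)%N & forall j, (lam y j <= maxn (k j) (k' j))%N].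
  move=> xyi.
  have le_y (j : 'I_a) : ((if j <= i then maxn (lam x j) (lam x i).+1 else lam x j) <= lam y j)%N.
    by have := lxy j; case: ifP => // ji; have := py _ _ ji; move: xyi; ord_lia.
  have [|k kE] := @ffun_of_nat a b
    (fun j => if (j <= i)%N then maxn (lam x j) (lam x i).+1 else lam x j).
    by move=> j; apply: leq_trans (le_y j) _; rewrite -ltnS.
  exists k => //.
  have kp : box_partition k.
    apply/box_partitionP => j1 j2 j12; have := px _ _ j12; rewrite !kE.
    by move: j12; case: ifP; case: ifP; ord_lia.
  have ku := inv_le kp; have kK := invK kp.
  have ky : inv k <= y by apply/(lam_le _ _).2 => // j; rewrite kK kE.
  have xk : x <= inv k.
    by apply/(lam_le _ _).2 => // j; rewrite kK kE; case: ifP => _ //; exact: leq_maxl.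
  have [|c [/andP[xc cy] kc1 kc2]] := H (inv k); first by rewrite xk.
  have cu := le_trans cy yu; have cp := lam_part cu.
  have /box_partitionP cpP := cp; have /box_partitionP kpP := kp.
  exists (lam c); split=> //.
    (* Meets in [L] are not given row by row, but the row-wise minimum is a partition below both
       elements, hence below their meet [x]; the maximum is used dually. *)
    move=> j; have [|m mE] := @ffun_of_nat a b (fun j => minn (k j) (lam c j)).
      by move=> i'; apply: leq_trans (geq_minl _ _) _; rewrite -ltnS.
    have mp : box_partition m.
      apply/box_partitionP => j1 j2 j12; rewrite !mE.
      by have := kpP _ _ j12; have := cpP _ _ j12; ord_lia.
    have mx : inv m <= x.
      rewrite -kc1 lexI; apply/andP; split; apply/lam_le; rewrite ?inv_le ?invK //.
        by move=> i'; rewrite mE geq_minl.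
      by move=> i'; rewrite mE geq_minr.
    by have := (lam_le (inv_le mp) xu).1 mx j; rewrite invK // mE.
  move=> j; have [|m mE] := @ffun_of_nat a b (fun j => maxn (k j) (lam c j)).
    by move=> i'; rewrite geq_max; apply/andP; split; rewrite -ltnS.
  have mp : box_partition m.
    apply/box_partitionP => j1 j2 j12; rewrite !mE.
    by have := kpP _ _ j12; have := cpP _ _ j12; ord_lia.
  have ym : y <= inv m.
    rewrite -kc2 leUx; apply/andP; split; apply/lam_le; rewrite ?inv_le ?invK //.
      by move=> i'; rewrite mE leq_maxl.
    by move=> i'; rewrite mE leq_maxr.
  by have := (lam_le yu (inv_le mp)).1 ym j; rewrite invK // mE.
split=> [i|i j ij].
  have := lxy i; case: (ltnP (lam x i).+1 (lam y i)) => [lt|]; last by ord_lia.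
  have [k kE [k' [_ h1 h2]]] := raise i (ltnW lt).
  by have := h1 i; have := h2 i; have := kE i; move: lt; rewrite leqnn; ord_lia.
(* If [lam x i < lam y j], the complement of the raised element stays within [lam x i] in row [i]
   but must reach [lam y j] in row [j], so it is no partition. *)
rewrite leqNgt; apply/negP => lt; have yij := py _ _ (ltnW ij).
have [|k kE [k' [/box_partitionP kp h1 h2]]] := raise i; first by move: yij lt; ord_lia.
have := h1 i; have := h2 j; have := kE i; have := kE j; rewrite leqnn leqNgt ij /=.
have := kp _ _ (ltnW ij); have := px _ _ (ltnW ij); move: yij lt; ord_lia.
Qed.

Lemma boolean_multichains_box_le k y : y <= u ->
  boolean_multichains k e y = box_chains k (lam y).
Proof.
elim: k y => [|k IH] y yu.
  rewrite /=; congr nat_of_bool; apply/eqP/eqP => [<-|y0].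
    have zp : box_partition ([ffun=> ord0] : {ffun 'I_a -> 'I_b.+1}).
      by apply/box_partitionP => i j _; rewrite !ffunE.
    apply/ffunP => i; apply/val_inj; rewrite ffunE /=.
    have := (lam_le (e_le u) (inv_le zp)).1 (e_le _) i.
    by rewrite invK // ffunE /= leqn0 => /eqP.
  by apply/le_anti; rewrite e_le /=; apply/(lam_le _ _).2 => // i; rewrite y0 ffunE.
rewrite boolean_multichains_recr /=.
rewrite (eq_bigl (fun z => boolean_itv z y && (z <= u))); last first.
  move=> z; case: (boolP (boolean_itv z y)) => //= /boolean_itv_le zy.
  by rewrite (le_trans zy yu).
rewrite (reindex_onto inv lam) /=; last by move=> z /andP[_ /lamK].
apply: eq_big => [m|m /andP[/andP[_ mu] /eqP mK]]; last by rewrite IH // mK.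
apply/andP/andP => [[/andP[bm mu] /eqP mK]|[mp ms]].
  by rewrite -mK lam_part //; split=> //; rewrite -boolean_itv_box.
by rewrite boolean_itv_box ?inv_le // invK // ms eqxx.
Qed.

Lemma boolean_multichains_box k :
  boolean_multichains k e u = box_chains k ([ffun=> ord_max] : {ffun 'I_a -> 'I_b.+1}).
Proof.
rewrite boolean_multichains_box_le //; congr box_chains.
have mp : box_partition ([ffun=> ord_max] : {ffun 'I_a -> 'I_b.+1}).
  by apply/box_partitionP => i j _; rewrite !ffunE.
apply/ffunP => i; apply/val_inj; rewrite ffunE /=.
have := (lam_le (inv_le mp) (lexx _)).1 (inv_le mp) i; rewrite invK // ffunE /=.
by have := ltn_ord (lam u i); ord_lia.
Qed.
End BoxLattice.

(** * Block shuffles as box partitions *)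

Section BlockShuffles.
Variables (n lo r hi : nat).
Hypotheses (lrh : lo <= r <= hi) (hn : hi <= n).
Implicit Types (v w : 'S_n).
Notation bs := (block_swap n).

Lemma sum_itv x y : x <= y <= n -> \sum_(i < n) (x <= i < y) = y - x.
Proof.
move=> xyn; have E : \sum_(i < n) (i < x) + \sum_(i < n) (x <= i < y) = \sum_(i < n) (i < y).
  by rewrite -big_split /=; apply: eq_bigr => i _; lia.
by move: E; rewrite !sum_lt_ord; lia.
Qed.

Lemma block_shuffle_inv w a b : right_weak_le w (bs lo r hi) -> a < b ->
  posn w b < posn w a -> (lo <= a < r) && (r <= b < hi).
Proof.
by move=> /right_weakP H ab /(H a b ab); rewrite !posn_block_swap // blk_inv.
Qed.

Lemma block_shuffle_pos w s : right_weak_le w (bs lo r hi) -> lo <= s < r ->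
  s <= posn w s <= s + (hi - r) /\
  forall b, r <= b < hi -> (posn w b < posn w s) = (b - r < posn w s - s).
Proof.
move=> ws sh; have inv a b := @block_shuffle_inv w a b ws.
have pn : posn w s <= n by have := posn_lt w s; lia.
have pE := sum_posn_lt w pn; have inj a b := @posn_inj _ w a b.
have s_lo : s <= posn w s.
  rewrite -[X in _ <= X]pE -[X in X <= _](@sum_lt_ord n s); last by lia.
  by apply: leq_sum => i _; have := inv i s; have := inj i s; lia.
have sumE y : r <= y <= hi -> \sum_(i < n) ((i < s) + (r <= i < y)) = s + (y - r).
  by move=> yh; rewrite big_split /= sum_lt_ord ?sum_itv; lia.
have s_hi : posn w s <= s + (hi - r).
  rewrite -[X in X <= _]pE -sumE; last by lia.
  by apply: leq_sum => i _; have := inv s i; case: (eqVneq (i : nat) s) => [->|]; lia.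
split=> [|b bh]; first by rewrite s_lo.
case: (ltnP (posn w b) (posn w s)) => h.
  have : s + (b.+1 - r) <= posn w s.
    rewrite -[X in _ <= X]pE -sumE; last by lia.
    apply: leq_sum => i _; have := inv i s; have := inj i s; have := inv i b; have := inj i b.
    by case: (eqVneq (i : nat) b) => [->|]; lia.
  by lia.
have : posn w s <= s + (b - r).
  rewrite -[X in X <= _]pE -sumE; last by lia.
  apply: leq_sum => i _; have := inv s i; have := inv b i; have := inj s b.
  by case: (eqVneq (i : nat) s) => [->|?]; [|case: (eqVneq (i : nat) b) => [->|?]]; lia.
by lia.
Qed.

Let a := r - lo.
Let b := hi - r.
Implicit Types (k : {ffun 'I_a -> 'I_b.+1}).

(* Row [i] of the box records how many large letters precede the small letter [r - 1 - i]. *)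
Definition box_of w : {ffun 'I_a -> 'I_b.+1} :=
  [ffun i : 'I_a => inord (posn w (r.-1 - i) - (r.-1 - i))].

Lemma box_ofE w (i : 'I_a) : right_weak_le w (bs lo r hi) ->
  box_of w i = posn w (r.-1 - i) - (r.-1 - i) :> nat.
Proof.
move=> ws; have ia : i < r - lo := ltn_ord i; rewrite ffunE inordK // ltnS.
have [|h _] := @block_shuffle_pos w (r.-1 - i) ws.
  by move: ia; move: (nat_of_ord i) => m; lia.
by rewrite leq_subLR; case/andP: h.
Qed.

Lemma box_of_part w : right_weak_le w (bs lo r hi) -> box_partition (box_of w).
Proof.
move=> ws; apply/box_partitionP => i j; rewrite leq_eqVlt => /orP[/eqP/val_inj -> //|ij].
rewrite !box_ofE // leqNgt; apply/negP => lt.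
have ia : i < r - lo := ltn_ord i; have ja : j < r - lo := ltn_ord j.
move: (nat_of_ord i) (nat_of_ord j) ia ja ij lt => {}i {}j ia ja ij lt.
have [|h1 B1] := @block_shuffle_pos w (r.-1 - i) ws; first by lia.
have [|h2 B2] := @block_shuffle_pos w (r.-1 - j) ws; first by lia.
have := B1 (r + (posn w (r.-1 - i) - (r.-1 - i))).
have := B2 (r + (posn w (r.-1 - i) - (r.-1 - i))).
have := @block_shuffle_inv w (r.-1 - j) (r.-1 - i) ws; lia.
Qed.

Lemma box_of_weak v w : right_weak_le v (bs lo r hi) -> right_weak_le w (bs lo r hi) ->
  (forall i, box_of v i <= box_of w i) -> right_weak_le v w.
Proof.
move=> vs ws H; apply/right_weakP => c d cd dc.
have := block_shuffle_inv vs cd dc => /andP[ch dh].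
have ia : r.-1 - c < a by rewrite /a; lia.
have := H (Ordinal ia); rewrite !box_ofE //=.
have -> : r.-1 - (r.-1 - c) = c by lia.
have [_ Bv] := block_shuffle_pos vs ch; have [_ Bw] := block_shuffle_pos ws ch.
by move: dc; rewrite Bv // Bw //; lia.
Qed.

(** With [box_of_weak] this makes weak order, [M] and Bruhat order agree on shuffles. Small values
    increase in [w], so one at most [s] at or beyond position [posn v s] forces [s] there as
    well. *)
Lemma box_of_bruhat v w : right_weak_le v (bs lo r hi) -> right_weak_le w (bs lo r hi) ->
  bruhat_le v w -> forall i, box_of v i <= box_of w i.
Proof.
move=> vs ws bru i; rewrite !box_ofE // leqNgt; apply/negP => lt.
have ia : i < r - lo := ltn_ord i; move: (nat_of_ord i) ia lt => {}i ia lt.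
set s := r.-1 - i in lt.
have sh : lo <= s < r by rewrite /s; lia.
have [|||c cs pc] := bruhat_right (p := posn v s) (c := s.+1) _ _ bru.
- by have := posn_lt v s; lia.
- by lia.
- by exists s.
by have := @block_shuffle_inv w c s ws; case: (eqVneq c s) pc => [->|]; lia.
Qed.

Definition box_row k (i : nat) : nat := if insub i is Some j then k j else 0.
Definition box_col k (m : nat) : nat := \sum_(i < a) (m < k i).

Lemma box_rowE k (i : 'I_a) : box_row k i = k i.
Proof. by rewrite /box_row valK. Qed.

Lemma box_row_col k i m : box_partition k -> i < a -> (m < box_row k i) = (i < box_col k m).
Proof.
move=> /box_partitionP kp ia; rewrite -[i]/(val (Ordinal ia)) box_rowE /=.
case: (ltnP m (k (Ordinal ia))) => h; apply/esym.
  rewrite -[i.+1](sum_lt_ord ia) /box_col; apply: leq_sum => j _.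
  by have := kp j (Ordinal ia); rewrite /=; lia.
apply/negbTE; rewrite -leqNgt -[i](sum_lt_ord (ltnW ia)) /box_col; apply: leq_sum => j _.
by have := kp (Ordinal ia) j; rewrite /=; lia.
Qed.

(** A large letter moves left past the small letters it precedes; a column of the box, a part of the
    conjugate partition, counts them. *)
Definition box_pos k (c : nat) : nat :=
  if lo <= c < r then c + box_row k (r.-1 - c)
  else if r <= c < hi then c - box_col k (c - r) else c.

Definition of_box k : 'S_n := mkpos n (box_pos k).

Lemma box_row_le k i : i < a -> box_row k i <= b.
Proof. by move=> ia; rewrite -[i]/(val (Ordinal ia)) box_rowE -ltnS. Qed.

Lemma box_col_le k m : box_col k m <= a.
Proof.
rewrite /box_col -[X in _ <= X](sum_lt_ord (leqnn a)); apply: leq_sum => i _.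
by rewrite ltn_ord; case: (_ < _).
Qed.

Lemma box_pos_small_big k c d : box_partition k -> lo <= c < r -> r <= d < hi ->
  box_pos k c != box_pos k d /\
  (box_pos k d < box_pos k c) = (d - r < box_row k (r.-1 - c)).
Proof.
move=> kp ch dh; rewrite /box_pos ch dh.
have -> : (lo <= d < r) = false by lia.
have ia : r.-1 - c < a by rewrite /a; lia.
have := box_row_col (d - r) kp ia; have := box_col_le k (d - r); rewrite {1}/a.
lia.
Qed.

Lemma box_pos_small k c d : box_partition k -> lo <= c -> c < d < r -> box_pos k c < box_pos k d.
Proof.
move=> kp ch dh; rewrite /box_pos.
have -> : lo <= c < r by lia.
have -> : lo <= d < r by lia.
have ia : r.-1 - c < a by rewrite /a; lia.
have ja : r.-1 - d < a by rewrite /a; lia.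
move/box_partitionP: kp => /(_ (Ordinal ja) (Ordinal ia)).
rewrite -!box_rowE /=; lia.
Qed.

Lemma box_pos_big k c d : box_partition k -> r <= c -> c < d < hi -> box_pos k c < box_pos k d.
Proof.
move=> kp ch dh; rewrite /box_pos.
have -> : (lo <= c < r) = false by lia.
have -> : (lo <= d < r) = false by lia.
have -> : r <= c < hi by lia.
have -> : r <= d < hi by lia.
have : box_col k (d - r) <= box_col k (c - r).
  by apply: leq_sum => i _; lia.
have := box_col_le k (c - r); rewrite {1}/a; lia.
Qed.

Lemma box_pos_range k c : box_partition k -> lo <= c < hi -> lo <= box_pos k c < hi.
Proof.
move=> kp ch; rewrite /box_pos; case: ifP => h.
  have := @box_row_le k (r.-1 - c); rewrite /a /b; lia.
have := box_col_le k (c - r); rewrite {1}/a; case: ifP; lia.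
Qed.

Lemma posn_of_box k c : box_partition k -> posn (of_box k) c = box_pos k c.
Proof.
move=> kp; apply: posn_mkpos.
have out x : ~~ (lo <= x < hi) -> box_pos k x = x by rewrite /box_pos; split_ifs; lia.
have rng x := @box_pos_range k x kp.
split=> [x xn|x xn|x y].
- case: (boolP (lo <= x < hi)) => h; first by have := rng x h; lia.
  by rewrite out.
- by apply: out; lia.
have ss c' d' := @box_pos_small k c' d' kp.
have bb c' d' := @box_pos_big k c' d' kp.
have sb c' d' := @box_pos_small_big k c' d' kp.
case: (boolP (lo <= x < hi)) => hx; case: (boolP (lo <= y < hi)) => hy.
- have := ss x y; have := ss y x; have := bb x y; have := bb y x.
  case: (ltnP x r) => xr; case: (ltnP y r) => yr; try lia.
    by have [||/eqP ne _] := sb x y; lia.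
    by have [||/eqP ne _] := sb y x; lia.
- by rewrite (out y hy); have := rng x hx; lia.
- by rewrite (out x hx); have := rng y hy; lia.
by rewrite !out.
Qed.

Lemma of_box_shuffle k : box_partition k -> right_weak_le (of_box k) (bs lo r hi).
Proof.
move=> kp; apply/right_weakP => c d cd; rewrite !posn_of_box // !posn_block_swap // => dc.
rewrite blk_inv //.
have out x : ~~ (lo <= x < hi) -> box_pos k x = x by rewrite /box_pos; split_ifs; lia.
have := @box_pos_range k c kp; have := @box_pos_range k d kp; have := out c; have := out d.
have := @box_pos_small k c d kp; have := @box_pos_big k c d kp; lia.
Qed.

Lemma of_boxK k : box_partition k -> box_of (of_box k) = k.
Proof.
move=> kp; apply/ffunP => i; apply/val_inj; rewrite /= box_ofE ?of_box_shuffle //.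
have ia : i < r - lo := ltn_ord i; rewrite posn_of_box // /box_pos.
have -> : lo <= r.-1 - i < r by move: (nat_of_ord i) ia => m; lia.
have -> : r.-1 - (r.-1 - i) = i by move: (nat_of_ord i) ia => m; lia.
by rewrite box_rowE addKn.
Qed.
End BlockShuffles.

(** * Counting boolean chains *)

Section Count.
Variables (n : nat) (M : middle_order n).
Notation multichains k w := (@boolean_multichains _ (ordered_perm M) k (1%g : 'S_n) w).

Lemma multichains_block_swap k lo hi r : hi <= n -> mid_root M lo hi r ->
  multichains k (block_swap n lo r hi) =
  box_chains k ([ffun=> ord_max] : {ffun 'I_(r - lo) -> 'I_(hi - r).+1}).
Proof.
move=> hn R; have [rh _ _] := R.
have lrh : lo <= r <= hi by lia.
apply: (@boolean_multichains_box _ (ordered_perm M) (1%g : 'S_n) (block_swap n lo r hi)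
  _ _ (@box_of n lo r hi) (@of_box n lo r hi)).
- exact: mid_le1.
- by move=> x /(le_block_swap hn R); apply: box_of_part.
- move=> x y /(le_block_swap hn R) xs /(le_block_swap hn R) ys; split.
    by move/mid_bruhat; apply: box_of_bruhat.
  by move=> H; apply/mid_weak/(box_of_weak (lo := lo) (r := r) (hi := hi)).
- by move=> m mp; apply/(le_block_swap hn R)/of_box_shuffle.
by move=> m mp; apply: of_boxK.
Qed.

Lemma multichains_join k u v : mid_meet M u v = 1%g ->
  multichains k (mid_join M u v) = multichains k u * multichains k v.
Proof.
move=> I1; rewrite (@boolean_multichains_prod _ (ordered_perm M) u v (1%g : 'S_n)) //.
- have E (w : ordered_perm M) : (((1%g : 'S_n) : ordered_perm M) `&` w)%O = (1%g : 'S_n).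
    by apply: (@mid_le_anti _ M); [exact: mid_meet_l|exact: mid_le1].
  by rewrite !E.
- exact: mid_le1.
exact: mid_le1.
Qed.

Lemma multichains_interval_rev k lo hi : lo <= hi <= n ->
  multichains k (interval_rev n lo hi) = \prod_(i < hi - lo) 'C(k, i).
Proof.
move: {-1}(hi - lo) (erefl (hi - lo)) => m.
elim/ltn_ind: m lo hi => m IH lo hi mE lhn.
case: (ltnP lo.+1 hi) => lh; last first.
  have -> : interval_rev n lo hi = 1%g.
    apply: posn_ext => a an; rewrite posn1 posn_interval_rev /rv; last by lia.
    by split_ifs; lia.
  rewrite boolean_multichains_diag; last exact: mid_le1.
  have : m <= 1 by lia.
  by case: (m) => [|[|]] // _; rewrite ?big_ord0 ?big_ord1 ?bin0.
have [|r R] := @mid_root_exists n M lo hi; first by lia.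
have [rh _ _] := R; have hn : hi <= n by lia.
have [I1 I2 <-] := root_complement hn R.
rewrite !multichains_join // multichains_block_swap //.
rewrite (IH (r - lo)) ?(IH (hi - r)) //; try lia.
(* The two halves contribute exactly the factors that [box_chains_full] absorbs, so the root
   disappears from the count. *)
rewrite mulnC box_chains_full; try lia.
by have -> : r - lo + (hi - r) = m by lia.
Qed.
End Count.

Local Open Scope ring_scope.

Theorem proposition5p4 (n l : nat) (hn : (1 <= n)%N) (hl : (1 <= l)%N)
    (M : middle_order n) :
  (#|boolean_chains (ordered_perm M) l|%:Z : int) =
  \sum_(0 <= k < l.+1)
    (-1) ^+ (l - k)%N * ('C(l, k))%:Z * (\prod_(0 <= i < n) ('C(k, i))%:Z).
Proof.
rewrite (@card_boolean_chains _ (ordered_perm M) l (1%g : 'S_n) (interval_rev n 0 n)).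
- rewrite (@strict_boolean_chains_alt _ (ordered_perm M)) big_mkord.
  apply: eq_bigr => k _; rewrite multichains_interval_rev ?leqnn // subn0 big_mkord.
  by congr (_ * _); exact: (big_morph Posz PoszM (erefl _)).
- exact: mid_le1.
move=> w; apply/(mid_le_rev M _ (lo := 0) (hi := n)) => [|a ha]; first by rewrite leqnn.
by apply: posn_out; lia.
Qed.
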